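(* Let $q$ be a prime power and $k,\delta,\alpha$ positive integers with $\alpha\ge3$ and $\gcd(\alpha-1,\delta-1)=1$. Then, with $q,k,\delta,\alpha$ fixed and $n\to\infty$, $$B_q(n,k,\delta;\alpha)=\Omega\!\left(q^{\left(k-\frac{\delta-1}{\alpha-1}\right)n}\,n^{\frac{1}{\alpha-1}}\right).$$
   Context: For a prime power $q$, $\mathcal{G}_q(n,k)$ denotes the set of all $k$-dimensional subspaces of $\mathbb{F}_q^n$. An $\alpha$-$(n,k,\delta)_q^c$ covering Grassmannian code is a subset $\mathcal{C}\subseteq\mathcal{G}_q(n,k)$ (no repeated codewords) such that every set of $\alpha$ distinct codewords of $\mathcal{C}$ spans a subspace of $\mathbb{F}_q^n$ of dimension at least $k+\delta$. $B_q(n,k,\delta;\alpha)$ denotes the maximum size of an $\alpha$-$(n,k,\delta)_q^c$ code. The implied constant in $\Omega(\cdot)$ may depend on $q,k,\delta,\alpha$ but not on $n$. *)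

(* Defs.v *)
From mathcomp Require Import all_boot all_order all_algebra all_field.

Set Implicit Arguments. Unset Strict Implicit. Unset Printing Implicit Defensive.
Import GRing.Theory.
Local Open Scope ring_scope.

(* A subspace of F^n is represented canonically by the square matrix <<U>>%MS
   (the canonical representative of a row space), so subspaces form a finType. *)
Definition is_subspace (F : finFieldType) (n : nat) (U : 'M[F]_n) : bool :=
  (<<U>>%MS == U).

Definition in_grassmannian (F : finFieldType) (n k : nat) (U : 'M[F]_n) : bool :=
  is_subspace U && (\rank U == k)%N.

Definition covering_code (F : finFieldType) (n k delta alpha : nat)
    (C : {set 'M[F]_n}) : bool :=
  [forall U in C, in_grassmannian k U] &&
  [forall S : {set 'M[F]_n}, (S \subset C) && (#|S| == alpha)%N ==>
      (k + delta <= \rank (\sum_(U in S) U)%MS)%N].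

Definition B (F : finFieldType) (n k delta alpha : nat) : nat :=
  (\max_(C : {set 'M[F]_n} | covering_code k delta alpha C) #|C|)%N.

(* Main.v *)
Require Import Defs.
From mathcomp Require Import all_boot all_order all_algebra all_field.
From mathcomp Require Import ring lra zify.
Set Implicit Arguments. Unset Strict Implicit. Unset Printing Implicit Defensive.
Import Order.TTheory GRing.Theory Num.Theory.
Local Open Scope ring_scope.

(** Write [a = alpha - 1] and [d = delta - 1].  Call an [alpha]-set of
    [k]-subspaces an edge if it spans dimension at most [k + d]; a code is an
    independent set of this hypergraph.

    The defect [a (dim span A - k) - d (#|A| - 1)] is submodular in [A], and it is
    at most [0] on edges.  Since there are [O(q^(s n))] sets of given size with
    span of dimension at most [s], a random sample of density slightly larger than
    [q^(- d n / a)] contains few sets [A] of bounded size with negative defect;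
    deleting a point of each leaves [S] on which the defect is nonnegative.  By
    submodularity the defect vanishes on intersections of edges of [S], which,
    as [a] and [d] are coprime, forces two edges to share at most one point and
    excludes triangles of edges.  The average degree on [S] is a small positive
    power of [q^n].

    In a triangle-free hypergraph the factor [(log degree)^(1/a)] over the
    trivial bound is gained by a deterministic version of the nibble.  Maintain a
    chosen set [I] and a pool [V] such that no edge has all but at most one point in
    [I] and the rest in [V].  With [N = #|V|] and a target [M], let [Q] be the
    expected number of edges inside [I] union a random subset of [V] of density
    [M / N].  One may delete a point of the pool, or choose a point [v] and
    delete its forced neighbours, the [u] such that some edge lies in
    [I] union [{u, v}].  If no single deletion lowers [Q] enough, all forced
    degrees are [O(N / M (Q / M + 1))], and averaging over all choices and
    deletions, weighted so that every point of the pool is removed at the same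
    rate, shows that some choice of [v] barely raises [Q / M - ln N].  Hence
    of order [M] points can be chosen before the pool is exhausted. *)

(** * One greedy move *)

Definition triangle_free (T : finType) (H : {set {set T}}) : Prop :=
  forall (e f g : {set T}) (a b c : T), e \in H -> f \in H -> g \in H ->
    e != f -> f != g -> e != g -> a != b -> b != c -> a != c ->
    a \in e -> b \in e -> b \in f -> c \in f -> c \in g -> a \in g -> False.

Definition active (T : finType) (H : {set {set T}}) (I V : {set T}) :=
  [set e in H | e \subset I :|: V].

(* The forced neighbours of [v]: choosing both [v] and [u] would complete an edge. *)
Definition nbr2 (T : finType) (H : {set {set T}}) (I V : {set T}) (v : T) :=
  [set u in V | (u != v) &&
     [exists e : {set T}, (e \in active H I V) && (e :&: V == [set v; u])]].

Definition potential (R : realFieldType) (T : finType) (H : {set {set T}})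
    (M : R) (I V : {set T}) : R :=
  \sum_(e in active H I V) (M / #|V|%:R) ^+ #|e :&: V|.

(** Traces of size at least two make every point of the pool safe to choose: moving it into [I]
    completes no edge. *)
Definition valid_state (T : finType) (H : {set {set T}}) (I V : {set T}) : Prop :=
  [disjoint I & V] /\ forall e, e \in active H I V -> (1 < #|e :&: V|)%N.

Definition pickV (T : finType) (H : {set {set T}}) (I V : {set T}) (v : T) :=
  (V :\ v) :\: nbr2 H I V v.

Lemma nbr2_sym (T : finType) (H : {set {set T}}) (I V : {set T}) u v :
  u \in V -> v \in V -> (u \in nbr2 H I V v) = (v \in nbr2 H I V u).
Proof.
by move=> uV vV; rewrite !inE uV vV eq_sym setUC.
Qed.

Lemma nbr2_self (T : finType) (H : {set {set T}}) (I V : {set T}) v :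
  v \notin nbr2 H I V v.
Proof. by rewrite inE eqxx andbF. Qed.

Lemma nbr2_sub (T : finType) (H : {set {set T}}) (I V : {set T}) v :
  nbr2 H I V v \subset V.
Proof. by apply/subsetP=> u; rewrite inE => /andP[]. Qed.

Lemma active_del (T : finType) (H : {set {set T}}) (I V : {set T}) u :
  [disjoint I & V] -> u \in V ->
  active H I (V :\ u) = [set e in active H I V | u \notin e].
Proof.
move=> dIV uV; apply/setP=> e; rewrite !inE -andbA; congr (_ && _).
have uI : u \notin I by rewrite (disjointFl dIV uV).
apply/subsetP/andP => [h|[/subsetP h ue] x xe].
  split; first by apply/subsetP => x /h; rewrite !inE => /orP[->//|/andP[_ ->]]; rewrite orbT.
  by apply/negP=> /h; rewrite !inE eqxx (negbTE uI).
move: (h x xe); rewrite !inE => /orP[->//|->].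
by rewrite andbT; case: eqP => [xu|]; [rewrite -xu xe in ue|rewrite orbT].
Qed.

Lemma setI_D1_notin (T : finType) (e V : {set T}) u :
  u \notin e -> e :&: (V :\ u) = e :&: V.
Proof.
move=> ue; apply/setP=> x; rewrite !inE.
by case: eqP => [->|//]; rewrite (negbTE ue).
Qed.

Lemma valid_state_del (T : finType) (H : {set {set T}}) (I V : {set T}) u :
  valid_state H I V -> u \in V -> valid_state H I (V :\ u).
Proof.
move=> [dIV h] uV; split.
  by apply: disjointWr dIV; apply: subD1set.
by move=> e; rewrite active_del // inE => /andP[ea ue]; rewrite setI_D1_notin // h.
Qed.

Lemma active_pick (T : finType) (H : {set {set T}}) (I V : {set T}) v :
  [disjoint I & V] -> v \in V ->
  active H (v |: I) (pickV H I V v) =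
    [set e in active H I V | [disjoint e & nbr2 H I V v]].
Proof.
move=> dIV vV; apply/setP=> e; rewrite !inE -andbA; congr (_ && _).
apply/subsetP/andP => [h|[/subsetP h ue] x xe].
  split; first by apply/subsetP => x /h; rewrite in_setU /pickV in_setU1 in_setU
     in_setD in_setD1 => /orP[/orP[/eqP->|->]|/and3P[_ _ ->]]; rewrite ?vV ?orbT.
  rewrite disjoint_subset; apply/subsetP=> x xe; rewrite inE; apply/negP=> xN.
  move: (h x xe); rewrite in_setU /pickV in_setU1 in_setD xN orbF => /orP[/eqP xv|xI].
    by move: xN; rewrite xv (negbTE (nbr2_self _ _ _ _)).
  by move/subsetP/(_ _ xN): (nbr2_sub H I V v); rewrite (disjointFr dIV xI).
have xN := disjointFr ue xe.
move: (h x xe); rewrite !in_setU in_set1 /pickV in_setD in_setD1 xN /=.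
by case: eqP; case: (_ \in I).
Qed.

Lemma pick_trace (T : finType) (H : {set {set T}}) (I V e : {set T}) v :
  [disjoint e & nbr2 H I V v] -> e :&: pickV H I V v = (e :&: V) :\ v.
Proof.
move=> d; apply/setP=> x; rewrite /pickV in_setD1 !in_setI in_setD in_setD1.
by case xe: (x \in e) => //=; rewrite ?andbF // (disjointFr d xe).
Qed.

(** A trace that shrinks to a single point [u] was [{v, u}] before, so [u] is a forced neighbour of
    [v]; surviving edges avoid these. *)
Lemma valid_state_pick (T : finType) (H : {set {set T}}) (I V : {set T}) v :
  valid_state H I V -> v \in V -> valid_state H (v |: I) (pickV H I V v).
Proof.
move=> [dIV h] vV; split.
  rewrite disjoint_sym disjoint_subset; apply/subsetP=> x.
  rewrite /pickV in_setD in_setD1 => /and3P[_ xv xV].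
  by rewrite inE in_setU1 negb_or xv (disjointFl dIV xV).
move=> e; rewrite active_pick // inE => /andP[ea ed].
rewrite pick_trace //; have := h e ea; rewrite (cardsD1 v (e :&: V)).
case vin: (v \in e :&: V) => //; rewrite add1n ltnS => c1.
rewrite ltn_neqAle c1 andbT; apply/negP => /eqP/esym/eqP/cards1P[u eu].
have euV : e :&: V = [set v; u] by rewrite -(setD1K vin) eu.
have : u \in (e :&: V) :\ v by rewrite eu set11.
rewrite !inE => /and3P[uv ue uV].
have : u \in nbr2 H I V v.
  by rewrite inE uV uv; apply/existsP; exists e; rewrite ea euV eqxx.
by rewrite (disjointFr ed ue).
Qed.

Lemma card_pickV (T : finType) (H : {set {set T}}) (I V : {set T}) v : v \in V ->
  (#|pickV H I V v| + (#|nbr2 H I V v| + 1))%N = #|V|.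
Proof.
move=> vV; rewrite /pickV (cardsD1 v V) vV (cardsD (V :\ v)).
rewrite (setIidPr _) ?subsetD1 ?nbr2_sub ?nbr2_self // addnA subnK 1?addnC //.
by apply/subset_leq_card; rewrite subsetD1 nbr2_sub nbr2_self.
Qed.

(** A common forced neighbour [v] comes from edges with traces [{u, v}] and [{u', v}]; together with
    [e] they form a triangle on [u], [v], [u']. *)
Lemma nbr2_disjoint (T : finType) (H : {set {set T}}) (I V : {set T}) e u u' :
  triangle_free H -> e \in active H I V -> u \in e :&: V -> u' \in e :&: V ->
  u != u' -> [disjoint nbr2 H I V u & nbr2 H I V u'].
Proof.
move=> tf eA; rewrite !inE => /andP[ue uV] /andP[u'e u'V] uu'.
rewrite disjoint_subset; apply/subsetP => v; rewrite !inE.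
move=> /and3P[vV vu /existsP[f /andP[fA /eqP fV]]].
apply/negP=> /and3P[_ vu' /existsP[g /andP[gA /eqP gV]]].
have mem f' a b : f' :&: V = [set a; b] -> (a \in f') /\ (b \in f').
  by move=> E; have := set21 a b; have := set22 a b; rewrite -E !inE => /andP[-> _] /andP[-> _].
have [uf vf] := mem _ _ _ fV; have [ug vg] := mem _ _ _ gV.
have inV x f' a b : f' :&: V = [set a; b] -> x \in f' -> x \in V -> (x == a) || (x == b).
  by move=> E xf xV; have: x \in f' :&: V by [rewrite inE xf]; rewrite E !inE.
have AH f' : f' \in active H I V -> f' \in H by rewrite inE => /andP[].
apply: (tf f g e u v u'); rewrite ?AH //; try by [].
- apply/negP=> /eqP E; rewrite E in uf.
  by have := inV _ _ _ _ gV uf uV; rewrite (negbTE uu') eq_sym (negbTE vu).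
- apply/negP=> /eqP E; rewrite -E in ue.
  by have := inV _ _ _ _ gV ue uV; rewrite (negbTE uu') eq_sym (negbTE vu).
- apply/negP=> /eqP E; rewrite -E in u'e.
  by have := inV _ _ _ _ fV u'e u'V; rewrite eq_sym (negbTE uu') eq_sym (negbTE vu').
- by rewrite eq_sym.
Qed.

(** By symmetry, choosing [v] destroys [e] exactly when [v] is a forced neighbour of some point of
    [e :&: V], and these neighbourhoods are disjoint. An exact count, rather than a union bound, is
    what lets the loss cancel in the average below. *)
Lemma card_nbr2_meet (T : finType) (H : {set {set T}}) (I V : {set T}) e :
  triangle_free H -> e \in active H I V ->
  (#|[set v in V | [disjoint e & nbr2 H I V v]]|
    + \sum_(u in e :&: V) #|nbr2 H I V u|)%N = #|V|.
Proof.
move=> tf eA.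
have -> : (\sum_(u in e :&: V) #|nbr2 H I V u|)%N
    = #|\bigcup_(u in e :&: V) nbr2 H I V u|.
  rewrite big_mkcond [\bigcup_(u in _) _]big_mkcond -sum1_card partition_disjoint_bigcup /=.
    by apply: eq_bigr => u _; case: ifP; rewrite ?big_set0 // sum1_card.
  move=> u u' uu'; case: ifP => ue; last by rewrite -setI_eq0 set0I.
  case: ifP => u'e; last by rewrite -setI_eq0 setI0.
  exact: (nbr2_disjoint tf eA).
rewrite -(cardsID [set v | [disjoint e & nbr2 H I V v]] V).
congr (_ + _)%N; first by apply: eq_card => v; rewrite !inE.
apply: eq_card => v; rewrite in_setD inE; apply/bigcupP/andP.
  move=> [u]; rewrite inE => /andP[ue uV] vu.
  have vV := subsetP (nbr2_sub H I V u) _ vu; split => //.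
  apply/negP => d; have := disjointFr d ue.
  by rewrite nbr2_sym // vu.
move=> [/pred0Pn[u /andP[/= ue uN]] vV].
have uV := subsetP (nbr2_sub H I V v) _ uN.
by exists u; [rewrite inE ue|rewrite nbr2_sym].
Qed.

Lemma bernoulli_expr (R : realFieldType) (y : R) (i : nat) :
  0 <= y <= 1 -> 1 - i%:R * y <= (1 - y) ^+ i.
Proof.
move=> /andP[y0 y1]; elim: i => [|i IH]; first by rewrite expr0; lra.
have : (1 - y) * (1 - i%:R * y) <= (1 - y) * (1 - y) ^+ i by rewrite ler_wpM2l //; lra.
rewrite -exprS; apply: le_trans; rewrite -natr1.
have : 0 <= i%:R * (y * y) by rewrite mulr_ge0 // mulr_ge0.
lra.
Qed.

(** The linear coefficient must be exactly [i], because linear terms cancel later; only the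
    quadratic error may be generous. *)
Lemma expr_inv_le (R : realFieldType) (y : R) (i r : nat) :
  0 <= y -> (i <= r)%N -> r%:R * y <= 1 / 2 ->
  (1 - y)^-1 ^+ i <= 1 + i%:R * y + 2 * r%:R ^+ 2 * y ^+ 2.
Proof.
move=> y0 ir ry.
have iy : i%:R * y <= r%:R * y by rewrite ler_wpM2r // ler_nat.
have iy0 : 0 <= i%:R * y by rewrite mulr_ge0.
case: (ltnP 0 i) => [i0|]; last first.
  rewrite leqn0 => /eqP->; rewrite expr0 mul0r addr0 lerDl -mulrA -exprMn mulr_ge0 // ?sqr_ge0 //; lra.
have y1 : y <= i%:R * y by rewrite ler_peMl // ler1n.
have B : 1 - i%:R * y <= (1 - y) ^+ i by apply: bernoulli_expr; lra.
rewrite exprVn.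
have : ((1 - y) ^+ i)^-1 <= (1 - i%:R * y)^-1 by rewrite lef_pV2 // posrE; lra.
move/le_trans; apply.
have : (i%:R * y) ^+ 2 <= (r%:R * y) ^+ 2 by rewrite ler_pXn2r // nnegrE; lra.
rewrite -[2 * _ * _]mulrA -exprMn.
move: (i%:R * y) (r%:R * y) iy iy0 ry y1 B => z w zw z0 w1 _ _ zw2.
rewrite -[X in X <= _]mul1r ler_pdivrMr; last by lra.
have : 0 <= (1 - z) * (w ^+ 2 - z ^+ 2) by rewrite mulr_ge0 //; lra.
have : 0 <= (1 - 2 * z) * (z * z) by rewrite mulr_ge0 ?mulr_ge0 //; lra.
rewrite !expr2; nra.
Qed.

Lemma active_trace_le (T : finType) (H : {set {set T}}) (I V e : {set T}) (r : nat) :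
  (forall e, e \in H -> (#|e| <= r)%N) -> e \in active H I V -> (#|e :&: V| <= r)%N.
Proof.
move=> Hr; rewrite inE => /andP[/Hr er _].
by apply: leq_trans er; apply/subset_leq_card/subsetIl.
Qed.

Lemma potential_del_le (R : realFieldType) (T : finType) (H : {set {set T}})
    (I V : {set T}) (r : nat) (M : R) (u : T) :
  (forall e, e \in H -> (#|e| <= r)%N) -> valid_state H I V -> 0 < M ->
  u \in V -> r%:R / #|V|%:R <= 1 / 2 :> R ->
  potential H M I (V :\ u) <=
    \sum_(e in active H I V | u \notin e) (M / #|V|%:R) ^+ #|e :&: V|
       * (1 + #|e :&: V|%:R / #|V|%:R + 2 * r%:R ^+ 2 / #|V|%:R ^+ 2).
Proof.
move=> Hr [dIV st] M0 uV rV; rewrite /potential active_del //.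
have N0 : (0 < #|V|)%N by apply/card_gt0P; exists u.
have N0' : 0 < #|V|%:R :> R by rewrite ltr0n.
rewrite (eq_bigl (fun e => (e \in active H I V) && (u \notin e))); last first.
  by move=> e; rewrite inE.
apply: ler_sum => e /andP[eA ue]; rewrite setI_D1_notin //.
have -> : M / #|V :\ u|%:R = M / #|V|%:R * (1 - #|V|%:R^-1)^-1.
  have -> : #|V :\ u|%:R = #|V|%:R - 1 :> R by rewrite (cardsD1 u V) uV natrD addrC addKr.
  rewrite -mulrA -invfM mulrBr mulr1 divff //; lra.
rewrite exprMn ler_wpM2l ?exprn_ge0 ?divr_ge0 ?(ltW M0) ?(ltW N0') //.
rewrite -[X in _ <= _ + _ * X]exprVn; apply: expr_inv_le => //; last exact: active_trace_le eA.
by rewrite invr_ge0 ltW.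
Qed.

(** Surviving edges gain from the smaller pool. Those through [v] also lose one trace point, which
    multiplies their weight by [#|V| / M]; the factor 2 absorbs the growth of the density. [Y]
    bounds the fraction of the pool lost and keeps the quadratic error independent of [v]. *)
Lemma potential_pick_le (R : realFieldType) (T : finType) (H : {set {set T}})
    (I V : {set T}) (r : nat) (M Y : R) (v : T) :
  (forall e, e \in H -> (#|e| <= r)%N) -> valid_state H I V -> 0 < M ->
  v \in V -> r%:R * Y <= 1 / 2 -> (#|nbr2 H I V v|%:R + 1) / #|V|%:R <= Y ->
  potential H M (v |: I) (pickV H I V v) <=
    \sum_(e in active H I V | [disjoint e & nbr2 H I V v])
       (M / #|V|%:R) ^+ #|e :&: V|
       * (1 + #|e :&: V|%:R * ((#|nbr2 H I V v|%:R + 1) / #|V|%:R)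
            + 2 * r%:R ^+ 2 * Y ^+ 2)
    + \sum_(e in active H I V | v \in e)
       2 * (#|V|%:R / M) * (M / #|V|%:R) ^+ #|e :&: V|.
Proof.
move=> Hr [dIV st] M0 vV rY; set y := (_ / _) => yY.
have N0 : (0 < #|V|)%N by apply/card_gt0P; exists v.
have N0' : 0 < #|V|%:R :> R by rewrite ltr0n.
have y0 : 0 <= y by rewrite divr_ge0 // ?addr_ge0 // ltW.
have ry : r%:R * y <= 1 / 2 by apply: le_trans rY; rewrite ler_wpM2l.
have yY2 : 2 * r%:R ^+ 2 * y ^+ 2 <= 2 * r%:R ^+ 2 * Y ^+ 2.
  by rewrite ler_wpM2l ?mulr_ge0 ?sqr_ge0 // ler_pXn2r // nnegrE // (le_trans y0).
rewrite /potential active_pick //.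
rewrite (eq_bigl (fun e => (e \in active H I V) && [disjoint e & nbr2 H I V v])); last first.
  by move=> e; rewrite inE.
have x0 : 0 < M / #|V|%:R by rewrite divr_gt0.
set x := M / #|V|%:R in x0 *.
have -> : M / #|pickV H I V v|%:R = x * (1 - y)^-1.
  have -> : #|pickV H I V v|%:R = #|V|%:R - (#|nbr2 H I V v|%:R + 1) :> R.
    by rewrite -(card_pickV H I vV) !natrD addrK.
  rewrite /x -mulrA -invfM mulrBr mulr1 /y mulrCA divff ?mulr1 //; lra.
set A := active H I V.
apply: (@le_trans _ _ (\sum_(e in A | [disjoint e & nbr2 H I V v])
   (x ^+ #|e :&: V| * (1 + #|e :&: V|%:R * y + 2 * r%:R ^+ 2 * Y ^+ 2)
    + (if v \in e then 2 * (#|V|%:R / M) * x ^+ #|e :&: V| else 0)))).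
  apply: ler_sum => e /andP[eA ed]; rewrite pick_trace //.
  have er := active_trace_le Hr eA.
  have c0 : 0 <= x ^+ #|e :&: V| by rewrite exprn_ge0 // ltW.
  case: ifP => ve; last first.
    rewrite addr0 (_ : _ :\ v = e :&: V); last first.
      by apply/setP=> z; rewrite !inE; case: eqP => // ->; rewrite ve.
    rewrite exprMn ler_wpM2l //.
    by apply: le_trans (expr_inv_le y0 er ry) _; rewrite lerD2l.
  have vin : v \in e :&: V by rewrite inE ve.
  have := er; rewrite (cardsD1 v (e :&: V)) vin /= add1n => er'.
  rewrite exprMn -[X in X <= _]add0r lerD //.
    apply: mulr_ge0; first by rewrite exprn_ge0 // ltW.
    by apply: addr_ge0; [apply: addr_ge0 => //; apply: mulr_ge0 | rewrite -mulrA mulr_ge0 // mulr_ge0 // sqr_ge0].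
  have key z : 2 * (#|V|%:R / M) * (x * z) = 2 * z.
    by rewrite /x; field; rewrite (gt_eqF M0) (gt_eqF N0').
  rewrite exprS key mulrC ler_wpM2r ?exprn_ge0 ?(ltW x0) //.
  have := @expr_inv_le R y #|(e :&: V) :\ v| r y0 (ltnW er') ry; move/le_trans; apply.
  have : #|(e :&: V) :\ v|%:R * y <= r%:R * y by rewrite ler_wpM2r // ler_nat ltnW.
  have : 0 <= r%:R * y by rewrite mulr_ge0.
  rewrite -[2 * _ * _]mulrA -exprMn expr2; nra.
rewrite big_split /= lerD2l -big_mkcondr /=.
rewrite [X in X <= _](eq_bigl (fun e => (e \in A) && (v \in e) && [disjoint e & nbr2 H I V v])); last first.
  by move=> e; rewrite -!andbA [X in _ && X]andbC.
rewrite [X in _ <= X](bigID (fun e : {set T} => [disjoint e & nbr2 H I V v])) /= lerDl.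
by apply: sumr_ge0 => e _; rewrite !mulr_ge0 ?exprn_ge0 ?invr_ge0 ?(ltW x0) ?(ltW M0).
Qed.

Lemma sum_weights_disjoint_le (R : realFieldType) (T : finType) (H : {set {set T}})
    (I V e : {set T}) (i : nat) (E : R) :
  triangle_free H -> e \in active H I V -> 0 <= E -> (0 < #|V|)%N ->
  \sum_(v in V | [disjoint e & nbr2 H I V v])
     (1 + i%:R * ((#|nbr2 H I V v|%:R + 1) / #|V|%:R) + E)
  <= #|V|%:R - \sum_(u in e :&: V) #|nbr2 H I V u|%:R + i%:R
     + i%:R * (\sum_(u in V) #|nbr2 H I V u|%:R) / #|V|%:R + #|V|%:R * E.
Proof.
move=> tf eA E0 N0; have N0' : 0 < #|V|%:R :> R by rewrite ltr0n.
under eq_bigr do rewrite -addrA.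
rewrite big_split /= sumr_const.
have -> : #|[pred v in V | [disjoint e & nbr2 H I V v]]|%:R
   = #|V|%:R - \sum_(u in e :&: V) #|nbr2 H I V u|%:R :> R.
  rewrite -(card_nbr2_meet tf eA) natrD natr_sum addrK.
  by congr (_%:R); apply: eq_card => v; rewrite !inE.
rewrite -!addrA !lerD2l.
apply: (@le_trans _ _ (\sum_(v in V) (i%:R * ((#|nbr2 H I V v|%:R + 1) / #|V|%:R) + E))).
  rewrite [X in _ <= X](bigID (fun v => [disjoint e & nbr2 H I V v])) /= lerDl.
  apply: sumr_ge0 => v _; apply: addr_ge0 => //; apply: mulr_ge0 => //.
  by apply: divr_ge0 => //; apply: addr_ge0.
rewrite big_split /= sumr_const -(mulr_natl E) [X in _ <= X]addrA lerD2r -mulr_sumr -mulr_suml.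
rewrite big_split /= sumr_const le_eqVlt; apply/orP; left; apply/eqP.
by field; rewrite (gt_eqF N0').
Qed.

(* The weights [K - #|nbr2 u|] make the total rate at which [u] leaves the pool equal
   to [K] for every [u], so the first-order terms of the deletions cancel. *)
Lemma greedy_step_average (R : realFieldType) (T : finType) (H : {set {set T}})
    (I V : {set T}) (r : nat) (M K : R) :
  triangle_free H -> (forall e, e \in H -> (#|e| <= r)%N) -> valid_state H I V ->
  0 < M -> (0 < #|V|)%N -> 0 <= K ->
  (forall u, u \in V -> #|nbr2 H I V u|%:R <= K) ->
  r%:R * ((K + 1) / #|V|%:R) <= 1 / 2 ->
  \sum_(v in V) potential H M (v |: I) (pickV H I V v)
   + \sum_(u in V) (K - #|nbr2 H I V u|%:R) * potential H M I (V :\ u)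
  <= potential H M I V *
     (#|V|%:R + (K * #|V|%:R - \sum_(u in V) #|nbr2 H I V u|%:R)
      + (r%:R + #|V|%:R * (2 * r%:R ^+ 2 * ((K + 1) / #|V|%:R) ^+ 2)
         + K * #|V|%:R * (2 * r%:R ^+ 2 / #|V|%:R ^+ 2)
         + 2 * r%:R * (#|V|%:R / M))).
Proof.
move=> tf Hr st M0 N0 K0 dK rY; have N0' : 0 < #|V|%:R :> R by rewrite ltr0n.
set N : R := #|V|%:R in N0' rY *; set Y := (K + 1) / N in rY *.
set E2 := 2 * _ * Y ^+ 2; set E3 := 2 * _ / N ^+ 2.
pose d u : R := #|nbr2 H I V u|%:R.
have d0 u : 0 <= d u by rewrite ler0n.
set A := active H I V.
pose x := M / N; have x0 : 0 < x by rewrite divr_gt0.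
pose i (e : {set T}) := #|e :&: V|.
have rN : r%:R / N <= 1 / 2.
  apply: le_trans rY; rewrite ler_wpM2l // /Y ler_pdivlMr // mulVf ?gt_eqF //; lra.
(* Regroup by edges: for each [e], the choices that spare it, the surcharge for choices inside it,
   and the deletions that spare it. *)
apply: (@le_trans _ _ (\sum_(e in A) x ^+ i e * (
   (\sum_(v in V | [disjoint e & nbr2 H I V v]) (1 + (i e)%:R * ((d v + 1) / N) + E2))
   + 2 * (N / M) * (i e)%:R
   + (1 + (i e)%:R / N + E3) * \sum_(u in V | u \notin e) (K - d u)))).
  under [X in _ <= X]eq_bigr do rewrite 2!mulrDr.
  rewrite 2!big_split /=; apply: lerD.
    apply: (@le_trans _ _ (\sum_(v in V)
      (\sum_(e in A | [disjoint e & nbr2 H I V v])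
         x ^+ i e * (1 + (i e)%:R * ((d v + 1) / N) + E2)
       + \sum_(e in A | v \in e) 2 * (N / M) * x ^+ i e))).
      apply: ler_sum => v vV; apply: potential_pick_le => //.
      by rewrite ler_pM2r ?invr_gt0 // lerD2r dK.
    rewrite big_split /=; apply: lerD.
      rewrite (exchange_big_dep (fun e => e \in A)) /=; last by move=> v e _ /andP[].
      apply: ler_sum => e eA; rewrite mulr_sumr le_eqVlt; apply/orP; left; apply/eqP.
      by apply: eq_bigl => v; rewrite eA.
    rewrite (exchange_big_dep (fun e => e \in A)) /=; last by move=> v e _ /andP[].
    apply: ler_sum => e eA; rewrite sumr_const -(mulr_natr (2 * (N / M) * x ^+ i e)) [2 * (N / M) * x ^+ _]mulrC -[X in X <= _]mulrA.
    rewrite ler_wpM2l ?exprn_ge0 ?(ltW x0) // ler_wpM2l //.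
      by rewrite mulr_ge0 // divr_ge0 // ltW.
    by rewrite ler_nat; apply/subset_leq_card/subsetP => v; rewrite unfold_in => /and3P[vV _ ve]; rewrite inE ve vV.
  apply: (@le_trans _ _ (\sum_(u in V) \sum_(e in A | u \notin e)
      (K - d u) * (x ^+ i e * (1 + (i e)%:R / N + E3)))).
    apply: ler_sum => u uV; rewrite -mulr_sumr ler_wpM2l ?subr_ge0 ?dK //.
    exact: potential_del_le.
  rewrite (exchange_big_dep (fun e => e \in A)) /=; last by move=> v e _ /andP[].
  apply: ler_sum => e eA; rewrite -mulr_suml mulrC mulrA le_eqVlt; apply/orP; left; apply/eqP.
  by congr (_ * _); apply: eq_bigl => v; rewrite eA.
rewrite /potential -/A -/N -/x mulr_suml; apply: ler_sum => e eA.
rewrite ler_wpM2l ?exprn_ge0 ?(ltW x0) //.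
have E20 : 0 <= E2 by rewrite /E2 -mulrA mulr_ge0 // mulr_ge0 // sqr_ge0.
have E30 : 0 <= E3 by rewrite /E3 divr_ge0 ?mulr_ge0 ?sqr_ge0.
have := sum_weights_disjoint_le (i e) tf eA E20 N0; rewrite -/N -/d => h1.
have ir : (i e)%:R <= r%:R :> R by rewrite ler_nat (active_trace_le Hr eA).
have h3 : \sum_(u in V | u \notin e) (K - d u)
   = K * N - \sum_(u in V) d u - K * (i e)%:R + \sum_(u in e :&: V) d u.
  have hV : \sum_(u in V) (K - d u) = K * N - \sum_(u in V) d u.
    by rewrite sumrB sumr_const mulr_natr.
  have heV : \sum_(u in V | u \in e) (K - d u) = K * (i e)%:R - \sum_(u in e :&: V) d u.
    rewrite (eq_bigl (fun u => u \in e :&: V)); last by move=> u; rewrite inE andbC.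
    by rewrite sumrB sumr_const mulr_natr.
  by move: hV; rewrite (bigID (fun u => u \in e)) /= heV; lra.
set S := \sum_(u in e :&: V) _ in h1 h3 *.
set D := \sum_(u in V) _ in h1 h3 *.
have SK : S <= K * (i e)%:R.
  rewrite /S mulr_natr -sumr_const; apply: ler_sum => u; rewrite inE => /andP[_]; exact: dK.
have D0 : 0 <= D by apply: sumr_ge0.
have S0 : 0 <= S by apply: sumr_ge0.
have DK : D <= K * N by rewrite /D mulr_natr -sumr_const; apply: ler_sum.
rewrite h3; have NM : 2 * (N / M) * (i e)%:R <= 2 * r%:R * (N / M).
  have : 0 <= (N / M) * (r%:R - (i e)%:R) by apply: mulr_ge0; rewrite ?subr_ge0 // divr_ge0 // ltW.
  lra.
have iN0 : 0 <= (i e)%:R / N by rewrite divr_ge0 // ltW.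
(* In the bracket of [e], the [S] lost to choices is returned by the deletions, the two terms
   [i e * D / N] cancel, and by [P2] the growth [K * i e] offsets the deletions inside [e]. Only the
   error terms are left. *)
have P1 : ((i e)%:R / N + E3) * (K * N - D - K * (i e)%:R + S)
    <= ((i e)%:R / N + E3) * (K * N - D).
  by apply: ler_wpM2l; [apply: addr_ge0|lra].
have P2 : (i e)%:R / N * (K * N) = K * (i e)%:R by field; rewrite gt_eqF.
have P3 : 0 <= E3 * D by rewrite mulr_ge0.
lra.
Qed.

Lemma card_nbr2_le (T : finType) (H : {set {set T}}) (I V : {set T}) u :
  (#|nbr2 H I V u| <= #|[set e in active H I V | (u \in e) && (#|e :&: V| == 2)]|)%N.
Proof.
set B := [set e in _ | _].
have inj : {in nbr2 H I V u &, injective (fun z => [set u; z])}.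
  move=> z z'; rewrite !inE => /and3P[_ zu _] /and3P[_ z'u _] E.
  by have := set22 u z; rewrite E !inE (negbTE zu) => /eqP.
rewrite -(card_in_imset inj).
apply: leq_trans (leq_imset_card (fun e : {set T} => e :&: V) B).
apply/subset_leq_card/subsetP => _ /imsetP[z zN ->].
move: zN; rewrite inE => /and3P[zV zu /existsP[e /andP[eA /eqP eV]]].
apply/imsetP; exists e => //; rewrite inE eA eV cards2 [u == z]eq_sym zu andbT /=.
by have := set21 u z; rewrite -eV inE => /andP[].
Qed.

Lemma nbr2_weight_le (R : realFieldType) (T : finType) (H : {set {set T}})
    (I V : {set T}) (x : R) u : 0 <= x ->
  #|nbr2 H I V u|%:R * x ^+ 2
    <= \sum_(e in active H I V | u \in e) x ^+ #|e :&: V|.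
Proof.
move=> x0.
rewrite (bigID (fun e : {set T} => #|e :&: V| == 2)) /=.
apply: (@le_trans _ _ (\sum_(e in active H I V | (u \in e) && (#|e :&: V| == 2)) x ^+ 2)).
  rewrite sumr_const -(mulr_natl (x ^+ 2)) ler_wpM2r ?exprn_ge0 // ler_nat.
  by apply: leq_trans (card_nbr2_le _ _ _ _) _; apply/subset_leq_card/subsetP=> e; rewrite inE.
rewrite -[X in X <= _]addr0; apply: lerD; last by apply: sumr_ge0 => e _; rewrite exprn_ge0.
rewrite le_eqVlt; apply/orP; left; apply/eqP.
rewrite [RHS](eq_bigl (fun e : {set T} => (e \in active H I V) && ((u \in e) && (#|e :&: V| == 2)))).
  by apply: eq_bigr => e /and3P[_ _ /eqP ->].
by move=> e; rewrite andbA.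
Qed.

(** Deleting [u] removes the weight [w] of its edges and multiplies the other weights by at most
    [1 + 2 * r / #|V|]. If the net drop is below [2 * M / #|V|], then [w] is small, while every
    forced neighbour of [u] contributes at least [(M / #|V|) ^+ 2] to [w]. *)
Lemma nbr2_card_le_of_del (R : realFieldType) (T : finType) (H : {set {set T}})
    (I V : {set T}) (r : nat) (M qb : R) (u : T) :
  (forall e, e \in H -> (#|e| <= r)%N) -> valid_state H I V -> 0 < M -> u \in V ->
  2 * r%:R <= #|V|%:R :> R -> potential H M I V <= qb * M ->
  potential H M I V - 2 * M / #|V|%:R <= potential H M I (V :\ u) ->
  #|nbr2 H I V u|%:R <= 2 * #|V|%:R / M * (r%:R * qb + 1).
Proof.
move=> Hr st M0 uV rN Qq Qu.
have N0 : 0 < #|V|%:R :> R by rewrite ltr0n; apply/card_gt0P; exists u.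
set N : R := #|V|%:R in rN Qu N0 *.
have r0 : 0 <= r%:R :> R by [].
have rN2 : r%:R / N <= 1 / 2 by rewrite ler_pdivrMr //; lra.
have := @potential_del_le R T H I V r M u Hr st M0 uV rN2; rewrite -/N => h.
set x := M / N; have x0 : 0 < x by rewrite divr_gt0.
set w := \sum_(e in active H I V | u \in e) x ^+ #|e :&: V|.
have wd := nbr2_weight_le H I V u (ltW x0); rewrite -/w in wd.
set Q' := \sum_(e in active H I V | u \notin e) x ^+ #|e :&: V|.
have QE : potential H M I V = w + Q' by rewrite /potential (bigID (fun e : {set T} => u \in e)).
have Q'0 : 0 <= Q' by apply: sumr_ge0 => e _; rewrite exprn_ge0 // ltW.
have w0 : 0 <= w by apply: sumr_ge0 => e _; rewrite exprn_ge0 // ltW.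
have h2 : potential H M I (V :\ u) <= Q' * (1 + 2 * (r%:R / N)).
  apply: le_trans h _; rewrite mulr_suml; apply: ler_sum => e /andP[eA _].
  rewrite ler_wpM2l ?exprn_ge0 ?(ltW x0) //.
  have i1 : #|e :&: V|%:R / N <= r%:R / N.
    by rewrite ler_pM2r ?invr_gt0 // ler_nat (active_trace_le Hr eA).
  have i2 : 2 * r%:R ^+ 2 / N ^+ 2 = 2 * (r%:R / N) * (r%:R / N) by field; rewrite gt_eqF.
  have : 0 <= (r%:R / N) * (1 - 2 * (r%:R / N)).
    by apply: mulr_ge0; [rewrite divr_ge0 // ltW|lra].
  rewrite i2; lra.
have h3 : w * N <= 2 * M + 2 * r%:R * Q'.
  have e1 : 2 * M / N * N = 2 * M by field; rewrite gt_eqF.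
  have e2 : r%:R / N * N = r%:R by field; rewrite gt_eqF.
  have : (w + Q' - 2 * M / N) * N <= (Q' * (1 + 2 * (r%:R / N))) * N.
    by rewrite ler_wpM2r ?(ltW N0) // -QE; lra.
  nra.
have h4 : w * N <= 2 * M * (1 + r%:R * qb).
  have : r%:R * Q' <= r%:R * (qb * M) by rewrite ler_wpM2l //; lra.
  lra.
have : #|nbr2 H I V u|%:R * x ^+ 2 * N <= 2 * M * (1 + r%:R * qb).
  by apply: le_trans h4; rewrite ler_wpM2r // ltW.
have -> : #|nbr2 H I V u|%:R * x ^+ 2 * N = #|nbr2 H I V u|%:R * (M ^+ 2 / N).
  by rewrite /x; field; rewrite gt_eqF.
rewrite -ler_pdivlMr ?divr_gt0 ?exprn_gt0 //; move/le_trans; apply.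
rewrite le_eqVlt; apply/orP; left; apply/eqP; field.
by rewrite !gt_eqF.
Qed.

(** The flag [b] tells a choice from a deletion. The term [2 * (#|V| - #|V'|) / #|V|] dominates
    [ln #|V| - ln #|V'|] when the pool at most halves, so the quantity [ln #|V| - Q / M] never drops
    in a deletion and drops by [O((qb + 1) / M)] in a choice. *)
Lemma greedy_step (R : realFieldType) (T : finType) (H : {set {set T}})
    (I V : {set T}) (r : nat) (M qb : R) :
  triangle_free H -> (forall e, e \in H -> (#|e| <= r)%N) -> (1 < r)%N ->
  valid_state H I V -> 0 < M -> M <= #|V|%:R -> 0 <= qb ->
  potential H M I V <= qb * M ->
  2 * r%:R ^+ 2 * (2 * r%:R * qb + 3) ^+ 2 <= M ->
  exists I' V' : {set T}, exists b : bool,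
    [/\ valid_state H I' V', V' \proper V, I' \subset I :|: V, #|I'| = (#|I| + b)%N &
        (#|V|%:R <= 2 * #|V'|%:R :> R) /\
        2 * (#|V|%:R - #|V'|%:R) / #|V|%:R
          + (potential H M I' V' - potential H M I V) / M
          <= b%:R * (13 * r%:R * qb + 12) / M].
Proof.
move=> tf Hr r1 st M0 MN qb0 Qq MB.
have r2 : 2 <= r%:R :> R by rewrite ler_nat.
set rr : R := r%:R in r2 MB *.
set N : R := #|V|%:R in MN *.
have N0 : 0 < N by lra.
pose a := 2 * rr * qb + 3; have rq0 : 0 <= rr * qb by rewrite mulr_ge0 //; lra.
have a3 : 3 <= a by rewrite /a; lra.
have ra6 : 6 <= rr * a.
  have : 0 <= (rr - 2) * (a - 3) by rewrite mulr_ge0 //; lra.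
  lra.
have MB' : 2 * (rr * a) ^+ 2 <= M by rewrite exprMn mulrA.
have Mra : 12 * (rr * a) <= M by rewrite expr2 in MB'; nra.
have Mr : 36 * rr <= M.
  have : 0 <= rr * (a - 3) by rewrite mulr_ge0 //; lra.
  lra.
have NV0 : (0 < #|V|)%N by rewrite -(ltr0n R).
have [dIV _] := st.
pose Q := potential H M I V.
(* A drop of [2 * M / N] in the potential pays exactly for the loss of one pool point. *)
case: (boolP [exists u in V, potential H M I (V :\ u) <= Q - 2 * M / N]).
  move=> /existsP[u /andP[uV Du]]; exists I, (V :\ u), false.
  have NE : #|V :\ u|%:R = N - 1 by rewrite /N (cardsD1 u V) uV natrD addrC addKr.
  split; rewrite ?addn0 ?subsetUl //.
  - exact: valid_state_del.
  - exact: properD1.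
  split; rewrite NE; first by lra.
  rewrite !mul0r opprB addrC subrKC mulr1.
  have : (potential H M I (V :\ u) - Q) / M <= - (2 * M / N) / M.
    by rewrite ler_pM2r ?invr_gt0 //; lra.
  rewrite -/Q; have -> : - (2 * M / N) / M = - (2 / N) by field; rewrite !gt_eqF.
  lra.
rewrite negb_exists => /forallP nb.
have Du u : u \in V -> Q - 2 * M / N <= potential H M I (V :\ u).
  by move=> uV; have := nb u; rewrite uV /= -ltNge => /ltW.
pose K := 2 * N / M * (rr * qb + 1).
have K0 : 0 <= K by rewrite mulr_ge0 // ?divr_ge0 //; lra.
have dK u : u \in V -> #|nbr2 H I V u|%:R <= K.
  move=> uV; apply: nbr2_card_le_of_del (Du u uV) => //.
  by rewrite -/N -/rr; lra.
pose Y := (K + 1) / N.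
have YM : Y <= a / M.
  have -> : Y = (2 * (rr * qb + 1)) / M + 1 / N by rewrite /Y /K; field; rewrite !gt_eqF.
  have : 1 / N <= 1 / M by rewrite !div1r lef_pV2.
  have -> : a / M = (2 * (rr * qb + 1)) / M + 1 / M by rewrite /a; field; rewrite gt_eqF.
  lra.
have Y0 : 0 <= Y by rewrite divr_ge0 // ?addr_ge0 // ltW.
have rY12 : 12 * (rr * Y) <= 1.
  have : rr * Y <= rr * (a / M) by rewrite ler_wpM2l //; lra.
  have : 12 * (rr * (a / M)) <= 1.
    have -> : 12 * (rr * (a / M)) = 12 * (rr * a) / M by field; rewrite gt_eqF.
    by rewrite ler_pdivrMr // mul1r.
  lra.
have rY : rr * Y <= 1 / 2 by lra.
have avg := greedy_step_average tf Hr st M0 NV0 K0 dK rY.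
rewrite -/N -/rr -/Q -/Y in avg.
set D := \sum_(u in V) #|nbr2 H I V u|%:R in avg.
set X := (rr + _ + _ + _) in avg.
have D0 : 0 <= D by apply: sumr_ge0.
have Q0 : 0 <= Q by apply: sumr_ge0 => e _; rewrite exprn_ge0 // divr_ge0 // ltW.
have low : (K * N - D) * (Q - 2 * M / N) <=
   \sum_(u in V) (K - #|nbr2 H I V u|%:R) * potential H M I (V :\ u).
  have -> : K * N - D = \sum_(u in V) (K - #|nbr2 H I V u|%:R).
    by rewrite sumrB sumr_const mulr_natr.
  rewrite mulr_suml; apply: ler_sum => u uV; apply: ler_wpM2l; last exact: Du.
  by rewrite subr_ge0 dK.
(* No deletion lowers the potential by more than [2 * M / N], so moving the deletion terms of [avg]
   to the other side cancels [(K * N - D) * Q] and costs at most [2 * K * M]. Some [v] is then no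
   worse than the average. *)
have sumP : \sum_(v in V) potential H M (v |: I) (pickV H I V v)
   <= \sum_(v in V) (Q + (Q * X + 2 * K * M) / N).
  rewrite sumr_const -(mulr_natr (Q + _)) -/N mulrDl -[_ / N * N]mulrA mulVf ?gt_eqF // mulr1.
  have e1 : (K * N - D) * (2 * M / N) <= 2 * K * M.
    have -> : (K * N - D) * (2 * M / N) = 2 * K * M - D * (2 * M / N) by field; rewrite gt_eqF.
    by rewrite gerBl mulr_ge0 // divr_ge0 //; lra.
  move: avg low; rewrite -/N; nra.
have [v vV Pv] : exists2 v, v \in V &
    potential H M (v |: I) (pickV H I V v) <= Q + (Q * X + 2 * K * M) / N.
  apply/exists_inP; apply: contraT; rewrite negb_exists_in => /forall_inP al.
  move: sumP; rewrite leNgt => /negP; case.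
  move/card_gt0P: (NV0) => [v vV].
  rewrite (bigD1 v) //= [X in _ < X](bigD1 v) //=; apply: ltr_leD.
    by rewrite ltNge al.
  by apply: ler_sum => z /andP[zV _]; apply: ltW; rewrite ltNge al.
exists (v |: I), (pickV H I V v), true.
have vI : v \notin I by rewrite (disjointFl dIV vV).
have NE : N - #|pickV H I V v|%:R = #|nbr2 H I V v|%:R + 1.
  by rewrite /N -(card_pickV H I vV) !natrD [#|pickV _ _ _ _|%:R + _]addrC addrK.
have yv : (#|nbr2 H I V v|%:R + 1) / N <= Y by rewrite ler_pM2r ?invr_gt0 // lerD2r dK.
split.
- exact: valid_state_pick.
- exact: sub_proper_trans (subsetDl _ _) (properD1 vV).
- by rewrite subUset sub1set inE vV orbT subsetUl.
- by rewrite cardsU1 vI addnC.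
split.
  have : (#|nbr2 H I V v|%:R + 1) / N * N <= Y * N by rewrite ler_wpM2r // ltW.
  rewrite -mulrA mulVf ?gt_eqF // mulr1 => yN.
  have : 0 <= (rr - 2) * Y by rewrite mulr_ge0 //; lra.
  have YN : 24 * Y <= 1 -> 24 * (Y * N) <= N.
    by move=> yy; rewrite mulrA ger_pMl.
  move=> ry; have := YN ltac:(lra); move: NE yN; lra.
rewrite NE -/Q mul1r.
have t1 : 2 * (#|nbr2 H I V v|%:R + 1) / N <= 2 * (a / M) by rewrite -mulrA ler_pM2l //; lra.
have KY : K / N <= a / M.
  by apply: le_trans YM; rewrite ler_pM2r ?invr_gt0 //; lra.
have t2 : (potential H M (v |: I) (pickV H I V v) - Q) / M <= Q / M * (X / N) + 2 * (K / N).
  have -> : Q / M * (X / N) + 2 * (K / N) = ((Q * X + 2 * K * M) / N) / M.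
    by field; rewrite !gt_eqF.
  by rewrite ler_pM2r ?invr_gt0 //; lra.
(* The four summands of [X / N] are at most [rr / M], [1 / M], [rr / M] and [2 * rr / M]. *)
have XN : X / N <= 5 * rr / M.
  have -> : X / N = rr / N + 2 * (rr * Y) ^+ 2 + 2 * (rr * (K / N)) * (rr / N) + 2 * rr / M.
    by rewrite /X; field; rewrite !gt_eqF.
  have x1 : rr / N <= rr / M by rewrite ler_pM2l ?lef_pV2 //; lra.
  have x2 : 2 * (rr * Y) ^+ 2 <= 1 / M.
    have : (rr * Y) ^+ 2 <= (rr * (a / M)) ^+ 2.
      have ra : rr * Y <= rr * (a / M) by rewrite ler_wpM2l //; lra.
      have rY0 : 0 <= rr * Y by apply: mulr_ge0 => //; lra.
      by rewrite ler_pXn2r // nnegrE; lra.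
    have -> : (rr * (a / M)) ^+ 2 = (rr * a) ^+ 2 / M / M by field; rewrite gt_eqF.
    have : 2 * ((rr * a) ^+ 2) / M / M <= M / M / M by rewrite !ler_pM2r ?invr_gt0.
    rewrite divff ?gt_eqF //; lra.
  have x3 : 2 * (rr * (K / N)) * (rr / N) <= rr / M.
    apply: le_trans x1; rewrite ger_pMl ?divr_gt0 //; last by lra.
    have : rr * (K / N) <= rr * Y by rewrite ler_wpM2l ?ler_pM2r ?invr_gt0 //; lra.
    lra.
  have x4 : 1 / M <= rr / M by rewrite ler_pM2r ?invr_gt0 //; lra.
  lra.
have t3 : Q / M * (X / N) <= qb * (5 * rr / M).
  apply: ler_pM => //; first by rewrite divr_ge0 // ltW.
    rewrite divr_ge0 ?(ltW N0) // /X !addr_ge0 ?mulr_ge0 ?exprn_ge0 ?divr_ge0 ?invr_ge0 ?exprn_ge0 //; lra.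
  by rewrite ler_pdivrMr.
have -> : (13 * rr * qb + 12) / M = qb * (5 * rr / M) + 4 * (a / M).
  by rewrite /a; field; rewrite gt_eqF.
lra.
Qed.

(** * Sampling a sparse family *)

Lemma sum_powersetU1 (R : nmodType) (T : finType) (V : {set T}) (v : T)
    (f : {set T} -> R) : v \notin V ->
  \sum_(A : {set T} | A \subset v |: V) f A
    = \sum_(A : {set T} | A \subset V) (f A + f (v |: A)).
Proof.
move=> vV; rewrite (bigID (fun A : {set T} => v \notin A)) /= big_split /=; congr (_ + _).
  by apply: eq_bigl => A; rewrite -subsetD1 setU1K.
rewrite (reindex_onto (fun A => v |: A) (fun A => A :\ v)) /=; last first.
  by move=> A /andP[_]; rewrite negbK => /setD1K.
apply: eq_bigl => A; rewrite setU11 andbT; apply/andP/idP => [[AV /eqP <-]|AV].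
  by rewrite -(setU1K vV) setSD.
by rewrite setUS // setU1K //; apply: contra vV; apply/subsetP.
Qed.

(** The left side is the expectation of the right side for a random [S] of density [p]. The proof is
    the method of conditional expectations: it decides the points one by one, [X0] and [X1] being
    the expectations with [v] left out and put in. *)
Lemma exists_sample (R : realFieldType) (T : finType) (p : R) (V : {set T})
    (w : {set T} -> R) : 0 <= p <= 1 ->
  exists2 S : {set T}, S \subset V &
    \sum_(A : {set T} | A \subset V) w A * p ^+ #|A|
      <= \sum_(A : {set T} | A \subset S) w A.
Proof.
move=> /andP[p0 p1]; have [n] := ubnP #|V|; elim: n => // n IH in V w *.
have [->|[v vV]] := set_0Vmem V => nV.
  exists set0; rewrite ?subxx //.
  rewrite !(big_pred1 set0) ?cards0 ?mulr1 //; by move=> A; rewrite subset0.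
have cV : (#|V :\ v| < n)%N by rewrite (cardsD1 v V) vV in nV.
have vV' : v \notin V :\ v by rewrite !inE eqxx.
rewrite -(setD1K vV) sum_powersetU1 //.
set V' := V :\ v in cV vV' *.
set X0 := \sum_(A : {set T} | A \subset V') w A * p ^+ #|A|.
set X1 := \sum_(A : {set T} | A \subset V') (w A + w (v |: A)) * p ^+ #|A|.
have -> : \sum_(A : {set T} | A \subset V')
    (w A * p ^+ #|A| + w (v |: A) * p ^+ #|v |: A|) = (1 - p) * X0 + p * X1.
  rewrite /X0 /X1 !mulr_sumr -big_split /=; apply: eq_bigr => A AV.
  have vA : v \notin A by apply: contra vV'; apply/subsetP.
  by rewrite cardsU1 vA add1n exprS; ring.
have [le|/ltW le] := lerP X1 X0.
  have [S SV hS] := IH V' w cV; exists S; first by apply: subset_trans SV (subsetUr _ _).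
  apply: le_trans hS; rewrite -/X0.
  have : p * X1 <= p * X0 by rewrite ler_wpM2l.
  lra.
have [S SV hS] := IH V' (fun A => w A + w (v |: A)) cV; exists (v |: S).
  by rewrite setUS.
rewrite sum_powersetU1; last by apply: contra vV'; apply/subsetP.
apply: le_trans hS; rewrite -/X1.
have : (1 - p) * X0 <= (1 - p) * X1 by rewrite ler_wpM2l // subr_ge0.
lra.
Qed.

(** The deletion method: sample with a weight that counts points, minus bad sets, minus [lam] times
    edges, then remove one point from each bad set in the sample. *)
Lemma exists_alteration (R : realFieldType) (T : finType) (p lam : R) (V : {set T})
    (bad E : {set {set T}}) :
  0 <= p <= 1 -> 0 <= lam -> set0 \notin bad ->
  exists S : {set T}, [/\ S \subset V, forall A, A \in bad -> ~~ (A \subset S) &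
    p * #|V|%:R - \sum_(A in bad | A \subset V) p ^+ #|A|
      - lam * \sum_(A in E | A \subset V) p ^+ #|A|
    <= #|S|%:R - lam * #|[set A in E | A \subset S]|%:R].
Proof.
move=> p01 lam0 bad0.
pose w (A : {set T}) : R := (#|A| == 1)%:R - (A \in bad)%:R - lam * (A \in E)%:R.
have wE (S : {set T}) (q : R) : \sum_(A : {set T} | A \subset S) w A * q ^+ #|A| =
   q * #|S|%:R - \sum_(A in bad | A \subset S) q ^+ #|A|
      - lam * \sum_(A in E | A \subset S) q ^+ #|A|.
  have aux (P : pred {set T}) : \sum_(A : {set T} | A \subset S) (P A)%:R * q ^+ #|A|
     = \sum_(A : {set T} | P A && (A \subset S)) q ^+ #|A|.
    rewrite [LHS](bigID P) /= [X in _ + X]big1 ?addr0.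
      by rewrite [RHS](eq_bigl (fun A : {set T} => (A \subset S) && P A)); [apply: eq_bigr => A /andP[_ ->]; rewrite mul1r|move=> A; rewrite andbC].
    by move=> A /andP[_ /negbTE->]; rewrite mul0r.
  rewrite (eq_bigr (fun A : {set T} => (#|A| == 1)%:R * q ^+ #|A|
     - (A \in bad)%:R * q ^+ #|A| - lam * ((A \in E)%:R * q ^+ #|A|))); last first.
    by move=> A _; rewrite /w; ring.
  rewrite !sumrB -mulr_sumr (aux (fun A => A \in bad)) (aux (fun A => A \in E)) (aux (fun A : {set T} => #|A| == 1)); congr (_ - _ - _).
  rewrite (eq_bigr (fun=> q)) => [|A /andP[/eqP-> _]]; last by rewrite expr1.
  rewrite sumr_const -(mulr_natr q); congr (_ * _%:R).
  rewrite -[RHS]bin1 -(cards_draws S 1) cardsE.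
  by apply: eq_card => A; rewrite !unfold_in andbC.
have [S SV] := exists_sample V w p01; rewrite wE => hS.
have := wE S 1; under eq_bigr do rewrite expr1n mulr1.
move=> E1; rewrite E1 mul1r in hS.
pose pk (A : {set T}) : option T := [pick x in A].
pose X := [set x in S | [exists A in bad, (A \subset S) && (pk A == Some x)]].
exists (S :\: X); split.
- exact: subset_trans (subsetDl _ _) SV.
- move=> A Ab; apply/negP => AS.
  have AS' := subset_trans AS (subsetDl _ _).
  (* Bad sets are nonempty, so [pk] does select a point of each of them. *)
  have [x pkA xA] : exists2 x, pk A = Some x & x \in A.
    rewrite /pk; case: pickP => [x xA|A0]; first by exists x.
    by move: Ab bad0; rewrite (_ : A = set0) => [->//|]; apply/setP=> x; rewrite inE A0.
  have /setDP[xS] := subsetP AS x xA; rewrite inE xS /= => /negP; apply.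
  by apply/existsP; exists A; rewrite Ab AS' pkA eqxx.
apply: le_trans hS _.
have cX : (#|X| <= #|[set A in bad | A \subset S]|)%N.
  rewrite -(card_imset X (@Some_inj _)).
  apply: leq_trans (leq_imset_card pk _); apply/subset_leq_card/subsetP.
  move=> y /imsetP[x xX ->]; move: xX.
  rewrite inE => /andP[_ /existsP[A /and3P[Ab AS /eqP pkA]]].
  by apply/imsetP; exists A; rewrite // inE Ab.
have one (F : {set {set T}}) : \sum_(A in F | A \subset S) 1 ^+ #|A| = #|[set A in F | A \subset S]|%:R :> R.
  rewrite (eq_bigr (fun=> 1)) => [|A _]; last by rewrite expr1n.
  by rewrite sumr_const cardsE.
rewrite !one.
have XS : X \subset S by apply/subsetP=> x; rewrite inE => /andP[].
have cS : #|S :\: X|%:R = #|S|%:R - #|X|%:R :> R.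
  by rewrite cardsD (setIidPr XS) natrB // subset_leq_card.
have : lam * #|[set A in E | A \subset S :\: X]|%:R <= lam * #|[set A in E | A \subset S]|%:R.
  rewrite ler_wpM2l // ler_nat; apply/subset_leq_card/subsetP => A; rewrite !inE.
  by move=> /andP[-> /subset_trans]; apply; apply: subsetDl.
move: cX; rewrite -(ler_nat R) cS; lra.
Qed.

(** The size bound [3 * a.+1] lets the defect hypothesis apply to a union of three edges. *)
Lemma sparse_triangle_free (T : finType) (rk : {set T} -> nat) (a d k : nat) (S : {set T}) :
  (1 < a)%N -> gcdn a d = 1%N ->
  (forall A B, (rk (A :|: B) + rk (A :&: B) <= rk A + rk B)%N) ->
  (forall x, x \in S -> rk [set x] = k) ->
  (forall A : {set T}, A \subset S -> (1 < #|A| <= 3 * a.+1)%N ->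
     (a * k + d * #|A|.-1 <= a * rk A)%N) ->
  triangle_free [set e : {set T} | [&& e \subset S, #|e| == a.+1 & (rk e <= k + d)%N]].
Proof.
move=> a1 cop sub rk1 sp.
set H := [set e | _].
(* Zero defect makes [a] divide [d * (#|X| - 1)]; by coprimality [a] divides [#|X| - 1], which is
   positive and at most [a]. *)
have tight (X : {set T}) : (1 < #|X| <= a.+1)%N -> (a * rk X = a * k + d * #|X|.-1)%N -> #|X| = a.+1.
  move=> /andP[X1 Xa] E.
  have : (a %| d * #|X|.-1)%N.
    by rewrite -(dvdn_addr _ (dvdn_mulr k (dvdnn a))) -E dvdn_mulr.
  rewrite Gauss_dvdr; last by rewrite /coprime cop.
  move=> /dvdn_leq; lia.
have edge e : e \in H -> [/\ e \subset S, #|e| = a.+1 & (a * rk e <= a * k + a * d)%N].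
  by rewrite inE => /and3P[-> /eqP-> h]; split=> //; rewrite -mulnDr leq_mul2l h orbT.
have lin e f : e \in H -> f \in H -> e != f -> (#|e :&: f| <= 1)%N.
  move=> /edge[eS ce re] /edge[fS cf rf] ef; rewrite leqNgt; apply/negP=> j1.
  have cU := cardsUI e f.
  have jle : (#|e :&: f| <= #|e|)%N by apply/subset_leq_card/subsetIl.
  have ule : (#|e| <= #|e :|: f|)%N by apply/subset_leq_card/subsetUl.
  have s1 := sp (e :|: f); rewrite subUset eS fS in s1.
  have s2 := sp (e :&: f); rewrite (subset_trans (subsetIl _ _) eS) in s2.
  have {}s1 := s1 isT ltac:(lia); have {}s2 := s2 isT ltac:(lia).
  have sb : (a * (rk (e :|: f) + rk (e :&: f)) <= a * (rk e + rk f))%N by rewrite leq_mul2l sub orbT.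
  have dd : (d * #|e :|: f|.-1 + d * #|e :&: f|.-1 = 2 * (a * d))%N.
    by rewrite -mulnDr [(a * d)%N]mulnC mulnCA; congr (_ * _)%N; lia.
  have E : #|e :&: f| = a.+1 by apply: tight; [lia|lia].
  move/negP: ef; apply; rewrite eqEcard ce cf leqnn andbT.
  have /eqP <- : e :&: f == e by rewrite eqEcard subsetIl E ce leqnn.
  exact: subsetIr.
move=> e f g x y z eH fH gH ef fg eg xy yz xz xe ye yf zf zg xg.
have [eS ce re] := edge _ eH; have [fS cf rf] := edge _ fH; have [gS cg rg] := edge _ gH.
have ef1 : e :&: f = [set y].
  by apply/eqP; rewrite eq_sym eqEcard sub1set inE ye yf cards1 lin.
have yS : y \in S by apply: (subsetP eS).
have cU := cardsUI e f; rewrite ef1 cards1 in cU.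
have sb := sub e f; rewrite ef1 rk1 // in sb.
have cV := cardsUI g (e :|: f).
have sb2 := sub g (e :|: f).
have X2 : (1 < #|g :&: (e :|: f)|)%N.
  have <- : #|[set x; z]| = 2%N by rewrite cards2 xz.
  by apply/subset_leq_card; rewrite subUset !sub1set !inE xg xe zg zf orbT.
have Xle : (#|g :&: (e :|: f)| <= #|g|)%N by apply/subset_leq_card/subsetIl.
have gle : (#|g| <= #|g :|: (e :|: f)|)%N by apply/subset_leq_card/subsetUl.
have s1 := sp (g :|: (e :|: f)); rewrite !subUset gS eS fS in s1.
have s2 := sp (g :&: (e :|: f)); rewrite (subset_trans (subsetIl _ _) gS) in s2.
have b1 : (1 < #|g :|: (e :|: f)| <= 3 * a.+1)%N.
  by move: X2 Xle gle cV cU a1; rewrite ce cf cg; clear; lia.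
have b2 : (1 < #|g :&: (e :|: f)| <= 3 * a.+1)%N.
  by move: X2 Xle; rewrite cg; clear; lia.
have {}s1 := s1 isT b1; have {}s2 := s2 isT b2.
have sbm : (a * (rk (e :|: f) + k) <= a * (rk e + rk f))%N by rewrite leq_mul2l sb orbT.
have sbm2 : (a * (rk (g :|: (e :|: f)) + rk (g :&: (e :|: f))) <= a * (rk g + rk (e :|: f)))%N
  by rewrite leq_mul2l sb2 orbT.
have dd : (d * #|g :|: (e :|: f)|.-1 + d * #|g :&: (e :|: f)|.-1 = 3 * (a * d))%N.
  rewrite -mulnDr [(a * d)%N]mulnC mulnCA; congr (_ * _)%N.
  by move: b1 b2 cV cU; rewrite ce cf cg; clear; lia.
(* Single points have defect 0, so [e :|: f] has defect at most 0. Submodularity with [g] then makes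
   [g :&: (e :|: f)] tight, hence all of [g]. But [g] meets each of [e] and [f] in at most one point
   and has at least three. *)
have E : #|g :&: (e :|: f)| = a.+1.
  apply: tight; first by move: X2 Xle; rewrite cg; clear; lia.
  move: s1 s2 sbm sbm2 dd re rf rg; rewrite !mulnDr; clear; lia.
have gsub : g = (g :&: e) :|: (g :&: f).
  by rewrite -setIUr; apply/eqP; rewrite eq_sym eqEcard subsetIl E cg leqnn.
have := (leq_card_setU (g :&: e) (g :&: f)).1; rewrite -gsub cg.
have ge : g != e by rewrite eq_sym.
have gf : g != f by rewrite eq_sym.
have := lin g e gH eH ge; have := lin g f gH fH gf; move: a1; clear; lia.
Qed.

(** * Subspaces of small span *)

Definition span_rank (F : finFieldType) (n : nat) (S : {set 'M[F]_n}) : nat :=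
  \rank (\sum_(U in S) U)%MS.

Definition grassmannian (F : finFieldType) (n k : nat) : {set 'M[F]_n} :=
  [set U | in_grassmannian k U].

Lemma span_rank1 (F : finFieldType) (n : nat) (U : 'M[F]_n) :
  span_rank [set U] = \rank U.
Proof. by rewrite /span_rank big_set1. Qed.

Lemma sumsmx_setS (F : finFieldType) (n : nat) (A B : {set 'M[F]_n}) :
  A \subset B -> (\sum_(U in A) U <= \sum_(U in B) U)%MS.
Proof.
move=> /subsetP AB; apply/sumsmx_subP => U UA.
exact: (sumsmx_sup U (AB U UA)).
Qed.

Lemma span_rank_submod (F : finFieldType) (n : nat) (A B : {set 'M[F]_n}) :
  (span_rank (A :|: B) + span_rank (A :&: B) <= span_rank A + span_rank B)%N.
Proof.
rewrite /span_rank -[X in (_ <= X)%N]mxrank_sum_cap leq_add // mxrankS //.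
  apply/sumsmx_subP => U; rewrite inE => /orP[UA|UB].
    exact: submx_trans (sumsmx_sup U UA (submx_refl _)) (addsmxSl _ _).
  exact: submx_trans (sumsmx_sup U UB (submx_refl _)) (addsmxSr _ _).
by rewrite sub_capmx !sumsmx_setS ?subsetIl ?subsetIr.
Qed.

Lemma exists_spanning_mx (F : finFieldType) (n s : nat) (B : 'M[F]_n) :
  (\rank B <= s)%N -> exists X : 'M[F]_(s, n), (B <= X)%MS.
Proof.
move=> rs; exists ((pid_mx (\rank B) : 'M_(s, \rank B)) *m row_base B).
rewrite -(eq_row_base B).
apply/submxP; exists (pid_mx (\rank B) : 'M_(\rank B, s)).
by rewrite mulmxA pid_mx_id // pid_mx_1 mul1mx.
Qed.

Lemma exists_grass_coord (F : finFieldType) (n k s : nat) (U : 'M[F]_n) (X : 'M[F]_(s, n)) :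
  U \in grassmannian F n k -> (U <= X)%MS ->
  exists Y : 'M[F]_(k, s), <<Y *m X>>%MS = U.
Proof.
rewrite inE => /andP[/eqP UU /eqP <-]; rewrite -(eq_row_base U) => /submxP[D E].
exists D; rewrite -E -[RHS]UU; apply/eq_genmx; exact: eq_row_base.
Qed.

(** Such a family is encoded by an [s] by [n] matrix whose row space contains the span, and by [t]
    coordinate matrices of size [k] by [s], one per member. *)
Lemma card_small_span (F : finFieldType) (n k s t : nat) :
  (#|[set A : {set 'M[F]_n} |
       [&& A \subset grassmannian F n k, #|A| == t & (span_rank A <= s)%N]]|
   <= #|F| ^ (s * n + k * s * t))%N.
Proof.
pose g (z : 'M[F]_(s, n) * {ffun 'I_t -> 'M[F]_(k, s)}) : {set 'M[F]_n} :=
  [set <<z.2 i *m z.1>>%MS | i : 'I_t].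
have -> : (#|F| ^ (s * n + k * s * t) = #|[set: 'M[F]_(s, n) * {ffun 'I_t -> 'M[F]_(k, s)}]|)%N.
  by rewrite cardsT card_prod card_ffun !card_mx card_ord expnD -expnM.
apply: leq_trans (leq_imset_card g _); apply/subset_leq_card/subsetP => A.
rewrite inE => /and3P[AG /eqP At As].
have [X BX] := exists_spanning_mx As.
have ex (i : 'I_t) : exists Y : 'M[F]_(k, s), <<Y *m X>>%MS = nth 0 (enum A) i.
  have UA : nth 0 (enum A) i \in A by rewrite -mem_enum mem_nth // -cardE At.
  apply: exists_grass_coord; first exact: (subsetP AG).
  exact: submx_trans (sumsmx_sup _ UA (submx_refl _)) BX.
have [Y hY] := fin_all_exists ex.
apply/imsetP; exists (X, finfun Y) => //; apply/setP => U; apply/idP/imsetP.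
  move=> UA; have iA : (index U (enum A) < t)%N by rewrite -At cardE index_mem mem_enum.
  by exists (Ordinal iA) => //; rewrite ffunE /= hY /= nth_index // mem_enum.
by move=> [i _ ->]; rewrite ffunE /= hY -mem_enum mem_nth // -cardE At.
Qed.

(** The matrices [row_mx 1%:M A] in reduced form have pairwise distinct row spaces. *)
Lemma card_grassmannian_ge (F : finFieldType) (k m : nat) :
  (#|F| ^ (k * m) <= #|grassmannian F (k + m) k|)%N.
Proof.
pose g (A : 'M[F]_(k, m)) : 'M[F]_(k + m) := <<row_mx 1%:M A>>%MS.
have inj : injective g.
  move=> A A' E; have : (row_mx 1%:M A <= row_mx 1%:M A')%MS.
    by rewrite -(genmxE (row_mx 1%:M A')) -[X in (_ <= X)%MS]E genmxE.
  move=> /submxP[D]; rewrite mul_mx_row mulmx1 => /eq_row_mx[<-].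
  by rewrite mul1mx.
rewrite -card_mx -(card_image inj); apply/subset_leq_card/subsetP => U /codomP[A ->].
rewrite inE /in_grassmannian /is_subspace genmx_id eqxx /= mxrank_gen eqn_leq rank_leq_row /=.
have := mxrankM_maxl (row_mx 1%:M A) (col_mx (1%:M : 'M[F]_k) (0 : 'M[F]_(m, k))).
by rewrite mul_row_col mulmx1 mulmx0 addr0 mxrank1.
Qed.

(** * Covering codes and sampled families of subspaces *)

Lemma code_size_le_B (F : finFieldType) (n k delta alpha : nat) (C : {set 'M[F]_n}) :
  C \subset grassmannian F n k ->
  (forall e : {set 'M[F]_n}, e \subset C -> #|e| = alpha -> (k + delta <= span_rank e)%N) ->
  (#|C| <= B F n k delta alpha)%N.
Proof.
move=> CG h; apply: (@leq_bigmax_cond _ _ (fun C : {set 'M[F]_n} => #|C|)).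
apply/andP; split.
  by apply/forall_inP => U UC; have := subsetP CG U UC; rewrite inE.
by apply/forallP => S; apply/implyP => /andP[SC /eqP Sa]; apply: h.
Qed.

Definition dense_sets (F : finFieldType) (n k a d : nat) : {set {set 'M[F]_n}} :=
  [set A : {set 'M[F]_n} | [&& A \subset grassmannian F n k, (1 < #|A| <= 3 * a.+1)%N
     & (a * span_rank A < a * k + d * #|A|.-1)%N]].

Definition low_span_sets (F : finFieldType) (n k a d : nat) (S : {set 'M[F]_n}) :=
  [set e : {set 'M[F]_n} | [&& e \subset S, #|e| == a.+1 & (span_rank e <= k + d)%N]].

(** Ranks are integers: [s] is the largest one compatible with negative defect. The resulting gap of
    at least one in [a * s] is what pays for the increased sampling density. *)
Lemma card_dense_le (F : finFieldType) (n k a d t : nat) :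
  (0 < a)%N ->
  exists s, (0 < a * k + d * t.-1 -> a * s < a * k + d * t.-1)%N /\
  (#|[set A in dense_sets F n k a d | #|A| == t]| <= #|F| ^ (s * n + k * s * t))%N.
Proof.
move=> a0; exists ((a * k + d * t.-1).-1 %/ a)%N; split.
  by move=> X0; have := leq_trunc_div (a * k + d * t.-1).-1 a; rewrite mulnC; lia.
apply: leq_trans (card_small_span F n k _ t); apply/subset_leq_card/subsetP => A.
rewrite !inE => /andP[/and3P[-> _ h] /eqP tA]; rewrite tA eqxx /= leq_divRL //.
by rewrite tA in h; rewrite mulnC; lia.
Qed.

Lemma sum_dense_le (R : realFieldType) (F : finFieldType) (k m a d b c0 : nat) :
  (0 < a)%N -> (0 < d)%N -> (16 * a.+1 <= #|F| ^ c0)%N ->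
  (forall t s, (1 < t <= 3 * a.+1)%N -> (a * s < a * k + d * t.-1)%N ->
     (s * (k + m) + k * s * t + k * k + c0 <= k * (k + m) + b * t.-1)%N) ->
  \sum_(A in dense_sets F (k + m) k a d) (#|F|%:R ^+ b)^-1 ^+ #|A|
    <= #|F|%:R ^+ (k * m) / #|F|%:R ^+ b / 4 :> R.
Proof.
move=> a0 d0 hc hts; set q : R := #|F|%:R; set p := (q ^+ b)^-1.
have q1 : 1 < q by rewrite ltr1n finNzRing_gt1.
have q0 : 0 < q by lra.
have p0 : 0 < p by rewrite invr_gt0 exprn_gt0.
(* The share of each size [t]: there are [3 * a.+1 + 1], at most [4 * a.+1], values of [t]. *)
pose T0 := q ^+ (k * m) * p / (16 * a.+1%:R).
have a10 : 0 < a.+1%:R :> R by rewrite ltr0n.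
have T00 : 0 <= T0.
  by rewrite ltW // divr_gt0 ?mulr_gt0 // exprn_gt0.
rewrite (partition_big (fun A : {set 'M[F]_(k + m)} => inord #|A| : 'I_(3 * a.+1).+1) predT) //=.
apply: (@le_trans _ _ (\sum_(t < (3 * a.+1).+1) T0)); last first.
  rewrite sumr_const card_ord -(mulr_natr T0) /T0.
  have -> : q ^+ (k * m) * p / (16 * a.+1%:R) * (3 * a.+1).+1%:R
     = q ^+ (k * m) * p / 4 * ((3 * a.+1).+1%:R / (4 * a.+1%:R)).
    have fld (x y z : R) : 0 < x -> z / (16 * x) * y = z / 4 * (y / (4 * x)).
      by move=> x0; field; rewrite gt_eqF.
    exact: fld.
  rewrite ger_pMr; last by rewrite divr_gt0 // mulr_gt0 // exprn_gt0.
  rewrite ler_pdivrMr ?mulr_gt0 // mul1r -natrM ler_nat; lia.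
apply: ler_sum => t _.
apply: (@le_trans _ _ (\sum_(A in [set A in dense_sets F (k + m) k a d | #|A| == t]) p ^+ t)).
  rewrite le_eqVlt; apply/orP; left; apply/eqP.
  have sz A : A \in dense_sets F (k + m) k a d -> (inord #|A| == t) = (#|A| == t).
    rewrite inE => /and3P[_ /andP[_ h] _].
    by rewrite -val_eqE /= inordK.
  rewrite [LHS](eq_bigl (fun A => A \in [set A in dense_sets F (k + m) k a d | #|A| == t])).
    by apply: eq_bigr => A; rewrite inE => /andP[_ /eqP->].
  by move=> A; rewrite inE; case AD: (A \in _) => //=; rewrite sz.
rewrite sumr_const -(mulr_natl (p ^+ t)).
case: (ltnP 1 t) => [t1|t1]; last first.
  rewrite (_ : [set A in _ | _] = set0) ?cards0 ?mul0r //.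
  apply/setP=> A; rewrite !inE; apply/negP => /andP[/and3P[_ /andP[h _] _] /eqP E].
  by rewrite E ltnNge t1 in h.
have [s [hs cs]] := card_dense_le F (k + m) k d t a0.
have tle : (1 < t <= 3 * a.+1)%N by rewrite t1 -ltnS ltn_ord.
have X0 : (0 < a * k + d * t.-1)%N by rewrite addn_gt0 (muln_gt0 d) d0 /= -subn1 subn_gt0 t1 orbT.
have h := hts t s tle (hs X0).
apply: (@le_trans _ _ (q ^+ (s * (k + m) + k * s * t) * p ^+ t)).
  by rewrite ler_wpM2r ?exprn_ge0 ?(ltW p0) // -natrX ler_nat.
rewrite /T0 ler_pdivlMr ?mulr_gt0 //.
have tE : t = t.-1.+1 :> nat by lia.
have -> : p ^+ t = p * p ^+ t.-1 by rewrite {1}tE exprS.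
have pt : p ^+ t.-1 = (q ^+ (b * t.-1))^-1 by rewrite /p exprVn -exprM.
have sw (x y z w : R) : x * y * z <= w -> x * (p * y) * z <= w * p.
  by move=> xw; rewrite (_ : x * (p * y) * z = x * y * z * p) ?ler_pM2r //; ring.
apply: sw; rewrite pt mulrAC ler_pdivrMr ?exprn_gt0 // -exprD.
apply: (@le_trans _ _ (q ^+ (s * (k + m) + k * s * t) * q ^+ c0)).
  rewrite ler_pM2l ?exprn_gt0 // -natrM -natrX ler_nat //.
rewrite -exprD ler_weXn2l ?(ltW q1) //; lia.
Qed.

Lemma sparse_sample (R : realFieldType) (F : finFieldType) (k m a d b c0 : nat) :
  (1 < a)%N -> gcdn a d = 1%N -> (a * b <= d * (k + m))%N -> (16 * a.+1 <= #|F| ^ c0)%N ->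
  (forall t s, (1 < t <= 3 * a.+1)%N -> (a * s < a * k + d * t.-1)%N ->
     (s * (k + m) + k * s * t + k * k + c0 <= k * (k + m) + b * t.-1)%N) ->
  exists S : {set 'M[F]_(k + m)},
    [/\ S \subset grassmannian F (k + m) k,
        triangle_free (low_span_sets k a d S),
        #|F|%:R ^+ (k * m) / #|F|%:R ^+ b / 2 <= #|S|%:R :> R &
        #|low_span_sets k a d S|%:R
          <= 4 * #|F|%:R ^+ (d * (k + m) - a * b + (k * (k + d) * a.+1 + k * k)) * #|S|%:R :> R].
Proof.
move=> a1 cop ab hc hts; have d0 : (0 < d)%N.
  by case: d cop {ab hts} => // /eqP; rewrite gcdn0; lia.
have a0 := ltnW a1.
have hsum := sum_dense_le R a0 d0 hc hts.
set q : R := #|F|%:R in hsum *; set p := (q ^+ b)^-1 in hsum *.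
have q1 : 1 < q by rewrite ltr1n finNzRing_gt1.
have q0 : 0 < q by lra.
have p0 : 0 < p by rewrite invr_gt0 exprn_gt0.
have p1 : p <= 1 by rewrite invf_le1 ?exprn_gt0 // exprn_ege1 // ltW.
set h := (d * (k + m) - a * b + _)%N.
set G := grassmannian F (k + m) k.
(* With this [lam] the edges cost at most [X / 4] in expectation, as do the dense sets. The
   remaining [X / 2] bounds [#|S|] from below and also forces [lam] times the number of edges to be
   at most [#|S|]. *)
pose lam := (4 * q ^+ h)^-1; have lam0 : 0 < lam by rewrite invr_gt0 mulr_gt0 ?exprn_gt0.
set X := q ^+ (k * m) * p in hsum.
have X0 : 0 < X by rewrite mulr_gt0 // exprn_gt0.
have bad0 : set0 \notin dense_sets F (k + m) k a d by rewrite inE cards0 andbF.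
have p01 : 0 <= p <= 1 by rewrite ltW.
have [S [SG nb]] := exists_alteration G (low_span_sets k a d G) p01 (ltW lam0) bad0.
have lowE : [set A in low_span_sets k a d G | A \subset S] = low_span_sets k a d S.
  apply/setP=> A; rewrite !inE andbC; case AS: (A \subset S) => //=.
  by rewrite (subset_trans AS SG).
rewrite lowE => hS.
have e1 : \sum_(A in dense_sets F (k + m) k a d | A \subset G) p ^+ #|A| <= X / 4.
  apply: le_trans hsum; rewrite [X in _ <= X](bigID (fun A : {set _} => A \subset G)) /= lerDl.
  by apply: sumr_ge0 => A _; rewrite exprn_ge0 // ltW.
have e2 : lam * \sum_(A in low_span_sets k a d G | A \subset G) p ^+ #|A| <= X / 4.
  have : \sum_(A in low_span_sets k a d G | A \subset G) p ^+ #|A|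
     <= q ^+ ((k + d) * (k + m) + k * (k + d) * a.+1) * p ^+ a.+1.
    rewrite (eq_bigr (fun=> p ^+ a.+1)); last by move=> A; rewrite inE => /andP[/and3P[_ /eqP-> _] _].
    rewrite sumr_const -(mulr_natl (p ^+ a.+1)) ler_wpM2r ?exprn_ge0 ?(ltW p0) //.
    rewrite -natrX ler_nat; apply: leq_trans (card_small_span F (k + m) k (k + d) a.+1).
    by apply/subset_leq_card/subsetP => A; rewrite unfold_in => /andP[h1 _]; move: h1; rewrite !inE.
  rewrite -(ler_pM2l lam0) => /le_trans; apply.
  have sw (x y z w v : R) : 0 < v -> x * y <= w * v -> (4 * v)^-1 * (x * (p * y)) <= w * p / 4.
    move=> v0 xw; rewrite (_ : _^-1 * _ = x * y / v * p / 4); last by field; rewrite gt_eqF.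
    by rewrite ler_pM2r ?invr_gt0 // ler_pM2r // ler_pdivrMr.
  rewrite exprS; apply: sw; rewrite ?exprn_gt0 //.
  rewrite /p exprVn -exprM ler_pdivrMr ?exprn_gt0 // -!exprD ler_weXn2l ?(ltW q1) //.
  by rewrite /h; move: ab; clear; lia.
have e3 : X <= p * #|G|%:R.
  by rewrite /X mulrC ler_pM2l // -natrX ler_nat card_grassmannian_ge.
have main : X / 2 <= #|S|%:R - lam * #|low_span_sets k a d S|%:R by lra.
have l0 : 0 <= lam * #|low_span_sets k a d S|%:R by rewrite mulr_ge0 // ltW.
exists S; split => //.
- apply: (@sparse_triangle_free _ (@span_rank F (k + m)) a d k S a1 cop (@span_rank_submod F (k + m))).
    by move=> U US; rewrite span_rank1; have := subsetP SG U US; rewrite inE => /andP[_ /eqP].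
  move=> A AS cA; rewrite leqNgt; apply/negP=> hA.
  have := nb A; rewrite inE (subset_trans AS SG) cA hA AS /= => /(_ isT).
  by [].
- by rewrite -/p -/X; lra.
rewrite -ler_pdivrMl ?mulr_gt0 ?exprn_gt0 // -/lam; lra.
Qed.

(** * Independent sets of logarithmically improved size *)

From mathcomp Require Import Rstruct.
From Stdlib Require Import Reals.
From mathcomp Require Import ring lra.
(* [Reals] rebinds the delimiter [N]; it also binds the arguments of [exp] and [ln]
   to its own scope. *)
Delimit Scope nat_scope with N.
Local Arguments exp _%_ring_scope.
Local Arguments ln _%_ring_scope.

Lemma Rexp_ge1D (x : R) : 1 + x <= exp x.
Proof. apply/RleP; exact: exp_ineq1_le. Qed.

Lemma Rler_ln (x y : R) : 0 < x -> x <= y -> ln x <= ln y.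
Proof.
move=> /RltP x0; rewrite le_eqVlt => /orP[/eqP->//|/RltP xy].
by apply/ltW/RltP; apply: ln_increasing.
Qed.

Lemma Rexp_gt0 (x : R) : 0 < exp x.
Proof. apply/RltP; exact: exp_pos. Qed.

Lemma Rler_exp (x y : R) : x <= y -> exp x <= exp y.
Proof.
rewrite le_eqVlt => /orP[/eqP->//|/RltP xy].
by apply/ltW/RltP; apply: exp_increasing.
Qed.

Lemma Rexp_lnK (x : R) : 0 < x -> exp (ln x) = x.
Proof. by move=> /RltP x0; rewrite exp_ln. Qed.

Lemma RexpD (x y : R) : exp (x + y) = exp x * exp y.
Proof. exact: exp_plus. Qed.

Lemma Rln_le_sub1 (x : R) : 0 < x -> ln x <= x - 1.
Proof. by move=> x0; have := Rexp_ge1D (ln x); rewrite Rexp_lnK //; lra. Qed.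

Lemma Rln_div (x y : R) : 0 < x -> 0 < y -> ln (x / y) = ln x - ln y.
Proof.
move=> x0 y0; have E : ln (exp (ln x - ln y)) = ln x - ln y by rewrite ln_exp.
have e1 : exp (- ln y) = y^-1.
  apply: (mulIf (lt0r_neq0 y0)); rewrite mulVf ?gt_eqF // -{2}(Rexp_lnK y0) -RexpD.
  by rewrite addNr; exact: exp_0.
by rewrite -E RexpD Rexp_lnK // e1.
Qed.

Lemma ratio_sub1_le (K : realFieldType) (a b : K) : 0 < a -> a <= b -> b <= 2 * a ->
  b / a - 1 <= 2 * (b - a) / b.
Proof.
move=> a0 ab b2; have b0 : 0 < b by lra.
have -> : b / a - 1 = (b - a) / a by field; rewrite gt_eqF.
by rewrite ler_pdivrMr // mulrAC ler_pdivlMr //; nra.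
Qed.

Lemma ln_sub_le (a b : R) : 0 < a -> a <= b -> b <= 2 * a ->
  ln b - ln a <= 2 * (b - a) / b.
Proof.
move=> a0 ab b2; have b0 : 0 < b by lra.
rewrite -Rln_div //; apply: le_trans (Rln_le_sub1 _) _; first by rewrite divr_gt0.
exact: ratio_sub1_le.
Qed.

(** Induction on the size of the pool. The inequality between logarithms is the invariant:
    [ln #|V| - potential H M I V / M] starts at [ln #|V0| - q0] or more and only choices lower
    it. *)
Lemma greedy_independent_set (T : finType) (H : {set {set T}}) (V0 : {set T}) (r J : nat)
    (M q0 : R) :
  triangle_free H -> (forall e, e \in H -> (#|e| <= r)%N) -> (1 < r)%N ->
  0 < M -> 0 <= q0 ->
  2 * r%:R ^+ 2 * (2 * r%:R * (2 * q0 + 1) + 3) ^+ 2 <= M ->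
  M * exp (2 * q0 + 1) <= #|V0|%:R -> J%:R * (26 * r%:R + 12) <= M ->
  forall n (I V : {set T}), (#|V| <= n)%N -> valid_state H I V ->
  V \subset V0 -> I \subset V0 -> (#|I| <= J)%N ->
  ln #|V0|%:R - q0 <= ln #|V|%:R - potential H M I V / M
     + #|I|%:R * (13 * r%:R * (2 * q0 + 1) + 12) / M -> (0 < #|V|)%N ->
  exists I' : {set T}, [/\ I' \subset V0, #|I'| = J &
     forall e, e \in H -> ~~ (e \subset I')].
Proof.
move=> tf Hr r1 M0 q00 MB V0M JM; elim=> [|n IH] I V nV st VV0 IV0 IJ inv Vpos.
  by move: Vpos; rewrite leqn0 in nV; rewrite (eqP nV).
move: IJ; rewrite leq_eqVlt => /orP[/eqP IJ|IJ].
  exists I; split=> // e eH; apply/negP=> eI.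
  have [dIV /(_ e)] := st; rewrite inE eH (subset_trans eI) ?subsetUl //= => /(_ isT).
  rewrite (_ : e :&: V = set0) ?cards0 //; apply/eqP.
  by rewrite setI_eq0; apply: disjointWl dIV.
have r2 : 2 <= r%:R :> R by rewrite ler_nat.
set rr : R := r%:R in r2 MB JM inv *; set L := 13 * _ * _ + 12 in inv.
set N : R := #|V|%:R in inv; set N0 : R := #|V0|%:R in V0M inv.
have N_0 : 0 < N by rewrite ltr0n.
have E0 := Rexp_gt0 (2 * q0 + 1).
have N00 : 0 < N0 by apply: lt_le_trans V0M; rewrite mulr_gt0.
have NN0 : N <= N0 by rewrite ler_nat subset_leq_card.
have L0 : 0 <= L by rewrite /L !addr_ge0 ?mulr_ge0 //; lra.
(* All [J] choices together cost at most [q0 + 1]. The invariant then keeps both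
   [ln #|V0| - ln #|V|] and [potential / M] below [2 * q0 + 1], the value used as [qb]. *)
have JL : J%:R * L / M <= q0 + 1.
  rewrite ler_pdivrMr //; apply: le_trans (_ : J%:R * ((26 * rr + 12) * (q0 + 1)) <= _).
    by rewrite ler_wpM2l // /L; nra.
  by rewrite mulrA [(q0 + 1) * M]mulrC ler_wpM2r //; lra.
have IL i : (i <= J)%N -> i%:R * L / M <= q0 + 1.
  move=> ij; apply: le_trans JL; rewrite ler_pM2r ?invr_gt0 // ler_wpM2r // ler_nat //.
have Q0 : 0 <= potential H M I V / M.
  apply: divr_ge0; last exact: ltW.
  by apply: sumr_ge0 => e _; rewrite exprn_ge0 // divr_ge0 // ltW.
have h := IL _ (ltnW IJ).
have ar1 (x y c d : R) : x - q0 <= y - c + d -> 0 <= c -> d <= q0 + 1 ->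
    x - (2 * q0 + 1) <= y /\ (y <= x -> c <= 2 * q0 + 1).
  by move=> *; split; lra.
have [lnN QM] := ar1 _ _ _ _ inv Q0 h.
have MN : M <= N.
  have := Rler_exp lnN; rewrite RexpD !Rexp_lnK //; apply: le_trans.
  rewrite -(ler_pM2r E0) -mulrA -RexpD addNr exp_0 mulr1 //.
have Qq : potential H M I V <= (2 * q0 + 1) * M.
  by rewrite -ler_pdivrMr //; apply: QM; apply: Rler_ln.
have qb0 : 0 <= 2 * q0 + 1 by lra.
have [I' [V' [b [st' pV' sI' cI' [hN hG]]]]] := greedy_step tf Hr r1 st M0 MN qb0 Qq MB.
rewrite -/rr -/L -/N in hN hG.
have N'0 : 0 < #|V'|%:R :> R by lra.
apply: (IH I' V') => //.
- by rewrite -ltnS (leq_trans (proper_card pV')).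
- exact: subset_trans (proper_sub pV') VV0.
- by apply: subset_trans sI' _; rewrite subUset IV0.
- by rewrite cI'; case: (b) => /=; rewrite ?addn1 ?addn0 // ltnW.
- have N'N : #|V'|%:R <= N by rewrite ler_nat subset_leq_card // proper_sub.
  have := ln_sub_le N'0 N'N hN; rewrite cI' natrD.
  rewrite mulrBl in hG.
  rewrite -/N0 -/rr -/L.
  have ar2 (x y y' c c' d d' t : R) : x - q0 <= y - c + d -> t + (c' - c) <= d' ->
    y - y' <= t -> x - q0 <= y' - c' + (d + d') by move=> *; lra.
  move=> hl; have := ar2 _ _ _ _ _ _ _ _ inv hG hl.
  by rewrite -!mulrDl.
- by rewrite -(ltr0n R).
Qed.

Lemma independent_set_triangle_free (T : finType) (H : {set {set T}}) (V : {set T})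
    (r J : nat) (M q0 : R) :
  triangle_free H -> (forall e, e \in H -> #|e| = r) ->
  (forall e, e \in H -> e \subset V) -> (1 < r)%N ->
  0 < M -> 0 <= q0 ->
  2 * r%:R ^+ 2 * (2 * r%:R * (2 * q0 + 1) + 3) ^+ 2 <= M ->
  M * exp (2 * q0 + 1) <= #|V|%:R -> J%:R * (26 * r%:R + 12) <= M ->
  #|H|%:R * (M / #|V|%:R) ^+ r <= q0 * M ->
  exists I : {set T}, [/\ I \subset V, #|I| = J &
     forall e, e \in H -> ~~ (e \subset I)].
Proof.
move=> tf Hr HV r1 M0 q00 MB VM JM HQ.
have V0 : (0 < #|V|)%N.
  by rewrite -(ltr0n R); apply: lt_le_trans VM; rewrite mulr_gt0 // Rexp_gt0.
have AH : active H set0 V = H.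
  by apply/setP => e; rewrite inE set0U; case eH: (e \in H) => //=; rewrite HV.
have tr e : e \in H -> #|e :&: V| = r by move=> eH; rewrite (setIidPl (HV e eH)) Hr.
apply: (@greedy_independent_set T H V r J M q0 tf _ r1 M0 q00 MB VM JM #|V| set0 V) => //.
- by move=> e /Hr ->.
- split; first by apply/pred0P=> x /=; rewrite inE.
  by move=> e; rewrite AH => /tr ->.
- exact: sub0set.
- by rewrite cards0.
rewrite cards0 !mul0r addr0 lerD2l lerN2 ler_pdivrMr //; apply: le_trans HQ.
rewrite /potential AH; under eq_bigr => e eH do rewrite tr //.
by rewrite sumr_const -(mulr_natl (_ ^+ r)).
Qed.

(** * Parameters and growth estimates *)

Lemma RexpX (x : R) (n : nat) : exp x ^+ n = exp (n%:R * x).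
Proof.
elim: n => [|n IH]; first by rewrite expr0 mul0r; symmetry; exact: exp_0.
by rewrite exprS IH -RexpD -natr1 mulrDl mul1r addrC.
Qed.

(** Here [b] is about [(d - 1 / w) * n / a], so the density [q ^ (- b)] exceeds [q ^ (- d * n / a)]
    by a small power of [q ^ n]. A negative defect saves [n / a] in the exponent, of which the
    larger density uses at most half because [2 * (t - 1) <= w]; the other half absorbs the
    constants. *)
Lemma sample_exponent (a d k w b c0 n : nat) :
  (0 < a)%N -> w = (6 * a.+1)%N -> b = (((w * d).-1 * n) %/ (w * a))%N -> (0 < d)%N ->
  (2 * a * (k * (k + d * (3 * a.+1)) * (3 * a.+1) + k * k + c0 + 3 * a.+1) <= n)%N ->
  [/\ (a * b <= d * n)%N, (n <= w * (d * n - a * b))%N &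
   forall t s, (1 < t <= 3 * a.+1)%N -> (a * s < a * k + d * t.-1)%N ->
     (s * n + k * s * t + k * k + c0 <= k * n + b * t.-1)%N].
Proof.
move=> a0 wE bE d0 nN.
have w0 : (0 < w)%N by rewrite wE.
have wd0 : (0 < w * d)%N by rewrite muln_gt0 w0.
have wa0 : (0 < w * a)%N by rewrite muln_gt0 w0.
have b1 : (b * (w * a) <= (w * d).-1 * n)%N by rewrite bE leq_trunc_div.
have b2 : ((w * d).-1 * n < b.+1 * (w * a))%N by rewrite bE ltn_ceil.
have wdn : ((w * d).-1 * n + n = w * (d * n))%N.
  by rewrite -mulSnr prednK // mulnA.
have bwa : (b * (w * a) = w * (a * b))%N by rewrite mulnC -mulnA.
have b3 : (w * (a * b) + n <= w * (d * n))%N by rewrite -bwa -wdn leq_add2r.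
have ab : (a * b <= d * n)%N.
  by rewrite -(leq_pmul2l w0) (leq_trans _ b3) // leq_addr.
split=> //.
  by rewrite mulnBr; move: b3; clear; lia.
move=> t s /andP[t1 t3] hs.
set tau := t.-1 in hs *.
have tauw : (2 * tau <= w)%N by rewrite /tau wE; move: t3; clear; lia.
have tau3 : (tau <= 3 * a.+1)%N by rewrite /tau; move: t3; clear; lia.
have sle : (s <= k + d * (3 * a.+1))%N.
  rewrite -(leq_pmul2l a0) mulnDr; apply: leq_trans (ltnW hs) _; rewrite leq_add2l.
  by rewrite mulnCA leq_mul2l (leq_trans tau3) ?orbT // leq_pmull.
have rest : (2 * a * (k * s * t + k * k + c0 + tau) <= n)%N.
  apply: leq_trans nN; rewrite leq_mul2l !leq_add ?orbT // -!mulnA leq_mul2l.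
  by rewrite leq_mul ?orbT.
have f1 : ((a * s + 1) * n <= (a * k + d * tau) * n)%N by rewrite leq_mul2r addn1 hs orbT.
have f2 : ((w * d).-1 * n * tau <= b.+1 * (w * a) * tau)%N by rewrite leq_mul2r (ltnW b2) orbT.
have f3 : (2 * tau * n <= w * n)%N by rewrite leq_mul2r tauw orbT.
have f4 : ((w * d).-1 * n * tau + n * tau = w * (d * n) * tau)%N by rewrite -mulnDl wdn.
rewrite -(leq_pmul2l wa0) -(leq_pmul2l (isT : 0 < 2)%N).
have f1' : (w * ((a * s + 1) * n) <= w * ((a * k + d * tau) * n))%N by rewrite leq_mul2l f1 orbT.
have rest' : (w * (2 * a * (k * s * t + k * k + c0 + tau)) <= w * n)%N by rewrite leq_mul2l rest orbT.
have -> : (s * n + k * s * t + k * k + c0 = s * n + (k * s * t + k * k + c0))%N by rewrite !addnA.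
move: f1' f2 f3 f4 rest'; clear.
move: ((w * d).-1)%N (k * s * t + k * k + c0)%N => u v.
nia.
Qed.

Lemma exp_ge_cube (x : R) : 0 <= x -> (x / 3) ^+ 3 <= exp x.
Proof.
move=> x0; have -> : exp x = exp (x / 3) ^+ 3.
  by rewrite RexpX; congr exp; field.
have gen (y e : R) : 0 <= y -> 1 + y <= e -> y ^+ 3 <= e ^+ 3.
  by move=> y0 ye; rewrite ler_pXn2r ?nnegrE //; lra.
by apply: gen; [rewrite divr_ge0|exact: Rexp_ge1D].
Qed.

Lemma square_le_exp (A C c n : R) : 0 < A -> 0 < c -> 0 < n -> C * (6 * A) ^+ 3 / c <= n ->
  C * n ^+ 2 <= c * exp (n / (2 * A)).
Proof.
move=> A0 c0 n0; rewrite ler_pdivrMr // => h.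
have x0 : 0 <= n / (2 * A) by rewrite divr_ge0 ?mulr_ge0 // ltW.
have := exp_ge_cube x0; rewrite -(ler_pM2l c0); apply: le_trans.
have -> : n / (2 * A) / 3 = n / (6 * A) by field; rewrite gt_eqF.
have A3 : 0 < (6 * A) ^+ 3 by rewrite exprn_gt0 // mulr_gt0.
have -> : c * (n / (6 * A)) ^+ 3 = c * n ^+ 3 / (6 * A) ^+ 3.
  by field; rewrite gt_eqF.
rewrite ler_pdivlMr //.
rewrite (_ : C * n ^+ 2 * (6 * A) ^+ 3 = n ^+ 2 * (C * (6 * A) ^+ 3)); last by ring.
rewrite (_ : c * n ^+ 3 = n ^+ 2 * (n * c)); last by ring.
by rewrite ler_pM2l // exprn_gt0.
Qed.

Lemma ln2_ge_half : 1 / 2 <= ln 2.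
Proof.
have := ln_lt_2 => /RltP/ltW.
have -> : IZR (Zpos 2) = 2 :> R by rewrite IZRposE INRE.
by rewrite RinvE div1r.
Qed.

Lemma RlnM (x y : R) : 0 < x -> 0 < y -> ln (x * y) = ln x + ln y.
Proof. by move=> /RltP x0 /RltP y0; rewrite ln_mult. Qed.

(** With [M = #|S| * x] the initial potential is at most [D * x ^+ a * M = q0 * M]. Since [x] is
    [(q0 / D)] to the power [1 / a], a [q0] of order [ln D] yields the logarithmic gain. *)
Lemma large_independent_set (T : finType) (H : {set {set T}}) (S : {set T}) (a : nat)
    (D q0 x : R) :
  triangle_free H -> (forall e, e \in H -> #|e| = a.+1) ->
  (forall e, e \in H -> e \subset S) -> (0 < a)%N -> 0 < x -> 0 <= q0 ->
  #|H|%:R <= D * #|S|%:R -> D * x ^+ a = q0 -> x * exp (2 * q0 + 1) <= 1 ->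
  2 * a.+1%:R ^+ 2 * (2 * a.+1%:R * (2 * q0 + 1) + 3) ^+ 2 <= #|S|%:R * x ->
  exists I : {set T}, [/\ I \subset S, forall e, e \in H -> ~~ (e \subset I) &
    #|S|%:R * x / (2 * (26 * a.+1%:R + 12)) <= #|I|%:R].
Proof.
move=> tf Hr HS a0 x0 q00 HD Dx xe MB.
set M := #|S|%:R * x in MB *; set rr : R := a.+1%:R in MB *.
have r2 : 2 <= rr by rewrite ler_nat.
have M84 : 2 * (26 * rr + 12) <= M.
  apply: le_trans MB; have y0 : 0 <= rr * q0 by rewrite mulr_ge0 //; lra.
  have ar (r y : R) : 2 <= r -> 0 <= r * y -> 2 * (26 * r + 12) <= 2 * r ^+ 2 * (2 * r * (2 * y + 1) + 3) ^+ 2.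
    move=> rr2 ry.
    have h7 : 7 ^+ 2 <= (2 * r * (2 * y + 1) + 3) ^+ 2 by rewrite ler_pXn2r ?nnegrE //; lra.
    have h : 2 * r ^+ 2 * 7 ^+ 2 <= 2 * r ^+ 2 * (2 * r * (2 * y + 1) + 3) ^+ 2.
      by rewrite ler_wpM2l // mulr_ge0 // sqr_ge0.
    by apply: le_trans h; rewrite !expr2; nra.
  exact: ar.
have M0 : 0 < M by lra.
have S0 : 0 < #|S|%:R :> R by move: M0; rewrite /M pmulr_lgt0.
set z := M / (26 * rr + 12); have w0 : 0 < 26 * rr + 12 by lra.
have z0 : 0 <= z by rewrite divr_ge0 // ltW.
have /andP[J1 J2] := truncn_itv z0.
set J := Num.truncn z in J1 J2.
have MS : M / #|S|%:R = x by rewrite /M mulrAC divff ?mul1r // gt_eqF.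
have [I [IS IJ Ind]] : exists I : {set T}, [/\ I \subset S, #|I| = J &
     forall e, e \in H -> ~~ (e \subset I)].
  apply: (@independent_set_triangle_free T H S a.+1 J M q0) => //.
  - by rewrite /M -mulrA ler_piMr // ltW.
  - by rewrite -ler_pdivlMr.
  rewrite MS -Dx /M exprSr; have xa0 : 0 <= x ^+ a * x by rewrite mulr_ge0 ?exprn_ge0 // ltW.
  have := ler_wpM2r xa0 HD; move/le_trans; apply.
  by rewrite le_eqVlt; apply/orP; left; apply/eqP; ring.
exists I; split => //; rewrite IJ.
have -> : M / (2 * (26 * rr + 12)) = z / 2 by rewrite /z invfM [2^-1 * _]mulrC mulrA.
(* Rounding [z] down loses at most half, as [z] is at least 2. *)
have : 2 <= z by rewrite /z ler_pdivlMr.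
move: J2; rewrite -natr1; lra.
Qed.

(** This is [A] times the logarithm of [x * exp (2 * q0 + 1) <= 1] for [q0 = n / (8 * A * W)] and
    [4 * q ^ h * x ^ A = q0]. With [y = n / W], the term [h * lq >= y / 2] outweighs
    [y / 16 + y / 4 + y / 6]. *)
Lemma ln_density_le0 (lq A W n h : R) : 2 <= A -> 0 < W -> 1 / 2 <= lq -> n <= W * h ->
  6 * A * W <= n ->
  ln (n / (8 * A * W)) - ln 4 - h * lq + A * (2 * (n / (8 * A * W)) + 1) <= 0.
Proof.
move=> A2 W0 lq0 nh nAW.
have A0 : 0 < A by lra.
have AW0 : 0 < A * W by rewrite mulr_gt0.
have n0 : 0 < n by lra.
have l1 : ln (n / (8 * A * W)) <= n / (8 * A * W) - 1 by apply: Rln_le_sub1; rewrite divr_gt0 //; lra.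
have l4 : 0 <= ln 4.
  have -> : 4 = 2 * 2 :> R by ring.
  by rewrite RlnM //; have := ln2_ge_half; lra.
pose y := n / W; have y0 : 0 < y by rewrite divr_gt0.
have e1 : n / (8 * A * W) = y / (8 * A) by rewrite /y; field; rewrite !gt_eqF.
have yh : y <= h by rewrite ler_pdivrMr // mulrC.
have ya : 6 * A <= y by rewrite ler_pdivlMr.
have e2 : y / (8 * A) <= y / 16.
  by rewrite ler_pM2l // lef_pV2 ?posrE; lra.
have e3 : A * (y / (8 * A)) = y / 8 by field; rewrite gt_eqF.
have hl : y * (1 / 2) <= h * lq by rewrite ler_pM //; lra.
rewrite e1 in l1 *; move: l1 l4 e2 e3 hl; lra.
Qed.

(** * The lower bound for covering codes *)

Lemma expr_Rexp (q : R) (n : nat) : 0 < q -> q ^+ n = exp (n%:R * ln q).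
Proof. by move=> q0; rewrite -RexpX Rexp_lnK. Qed.

Lemma Rexp0 : exp 0 = 1 :> R.
Proof. exact: exp_0. Qed.

Lemma RexpN (x : R) : exp (- x) = (exp x)^-1.
Proof.
have e0 := Rexp_gt0 x.
apply: (mulIf (lt0r_neq0 e0)).
by rewrite mulVf ?gt_eqF // -RexpD addNr Rexp0.
Qed.

Lemma ln_card_field_ge (F : finFieldType) : 1 / 2 <= ln (#|F|%:R : R).
Proof.
apply: le_trans ln2_ge_half _; apply: Rler_ln => //.
by rewrite ler_nat finNzRing_gt1.
Qed.

(** The sampling exponent [b] cancels between the sample size and [x]; the summand [ln nn / A] comes
    from [q0 = eta * nn] and is the gained factor. *)
Lemma sample_size_ge (q N' eta nn A k d m b h c1 : R) :
  0 < q -> 0 < eta -> 0 < nn -> 0 < A -> nn = k + m -> h = d * nn - A * b + c1 ->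
  exp (k * m * ln q - b * ln q - ln 2) <= N' ->
  exp (- ln 2 - k * k * ln q + (ln eta - ln 4 - c1 * ln q) / A)
    * exp ((k - d / A) * nn * ln q + ln nn / A)
  <= N' * exp ((ln (eta * nn) - ln 4 - h * ln q) / A).
Proof.
move=> q0 eta0 nn0 A0 nE hE hN.
apply: le_trans (ler_wpM2r (ltW (Rexp_gt0 _)) hN).
rewrite -!RexpD RlnM // hE le_eqVlt; apply/orP; left; apply/eqP; congr exp.
move: (ln q) (ln eta) (ln nn) (ln 4) (ln 2) => lq le ln4 ln2 lnn.
by rewrite nE; field; rewrite gt_eqF.
Qed.

Lemma code_lower_bound (F : finFieldType) (k d a : nat) :
  (1 < a)%N -> gcdn a d = 1%N -> (d < k * a)%N ->
  exists c : R, 0 < c /\ exists N : nat, forall n : nat, (N <= n)%N ->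
    c * exp ((k%:R - d%:R / a%:R) * n%:R * ln #|F|%:R + ln n%:R / a%:R)
      <= (B F n k d.+1 a.+1)%:R.
Proof.
move=> a1 cop dka; have a0 := ltnW a1.
have d0 : (0 < d)%N by case: d cop {dka} => // /eqP; rewrite gcdn0; lia.
set q : R := #|F|%:R; set lq := ln q.
have lq0 : 1 / 2 <= lq by exact: ln_card_field_ge.
have q2 : 2 <= q by rewrite ler_nat finNzRing_gt1.
have q0 : 0 < q by lra.
set A : R := a%:R; have A2 : 2 <= A by rewrite ler_nat.
have A0 : 0 < A by lra.
pose w := (6 * a.+1)%N; pose W : R := w%:R; have W0 : 0 < W by rewrite ltr0n.
pose eta := (8 * A * W)^-1.
have eta0 : 0 < eta by rewrite invr_gt0 !mulr_gt0.
pose rr : R := a.+1%:R; have rr0 : 0 < rr by rewrite ltr0n.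
pose c1 := (k * (k + d) * a.+1 + k * k)%N.
pose c0 := (16 * a.+1)%N.
pose cst := exp (- ln 2 - k%:R * k%:R * lq + (ln eta - ln 4 - c1%:R * lq) / A).
have cst0 : 0 < cst by exact: Rexp_gt0.
(* Since [q0' = eta * nn] and [nn >= 1], [C2 * nn ^+ 2] dominates the lower bound required of
   [M]. *)
pose C2 := 2 * rr ^+ 2 * (4 * rr * eta + 2 * rr + 3) ^+ 2.
pose Z := (2 * a * (k * (k + d * (3 * a.+1)) * (3 * a.+1) + k * k + c0 + 3 * a.+1))%N.
exists (cst / (2 * (26 * rr + 12))); split.
  by rewrite divr_gt0 // mulr_gt0 // addr_gt0 // mulr_gt0.
exists (k + Z + 6 * a * w + (Num.truncn (C2 * (6 * A) ^+ 3 / cst)).+1)%N => n nN.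
have kn : (k <= n)%N by move: nN; clear; lia.
have Zn : (Z <= n)%N by move: nN; clear; lia.
have awn : (6 * a * w <= n)%N by move: nN; clear; lia.
have Cn : (Num.truncn (C2 * (6 * A) ^+ 3 / cst) < n)%N by move: nN; clear; lia.
have n0 : (0 < n)%N by move: Cn; clear; lia.
clear nN.
pose m := (n - k)%N; have nE : n = (k + m)%N by rewrite subnKC.
move: kn Zn awn Cn n0; rewrite {}nE; move: m => m _ Zn awn Cn n0.
set nn : R := (k + m)%:R.
have nn1 : 1 <= nn by rewrite ler1n.
have nn0 : 0 < nn by lra.
pose b := ((((w * d).-1 * (k + m)) %/ (w * a)))%N.
have [ab nh hts] := @sample_exponent a d k w b c0 (k + m) a0 erefl erefl d0 Zn.
have hc : (16 * a.+1 <= expn #|F| c0)%N by apply: ltnW; apply: ltn_expl; exact: finNzRing_gt1.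
have [S [SG tf Sbig HS]] := sparse_sample R a1 cop ab hc hts.
rewrite -/q -/c1 in Sbig HS.
set h := (d * (k + m) - a * b + c1)%N in HS.
pose q0' := nn / (8 * A * W).
(* The solution of [4 * q ^+ h * x ^+ a = q0'], where [4 * q ^+ h] bounds the ratio of edges to
   points. *)
pose x := exp ((ln q0' - ln 4 - h%:R * lq) / A).
have x0 : 0 < x by exact: Rexp_gt0.
have q0'0 : 0 < q0' by rewrite divr_gt0 // !mulr_gt0.
have big : cst * exp ((k%:R - d%:R / A) * nn * lq + ln nn / A) <= #|S|%:R * x.
  rewrite /cst /x /q0' mulrC [nn / _]mulrC mulrC.
  apply: (@sample_size_ge q _ eta nn A k%:R d%:R m%:R b%:R) => //.
  - by rewrite /nn natrD.
  - by rewrite /h natrD natrB // !natrM.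
  apply: le_trans Sbig; rewrite !RexpD !RexpN Rexp_lnK // -natrM.
  by rewrite -!expr_Rexp.
have xD : 4 * q ^+ h * x ^+ a = q0'.
  rewrite /x RexpX -/A mulrC (_ : A * (_ / A) = ln q0' - ln 4 - h%:R * lq); last first.
    by rewrite mulrC divfK // gt_eqF.
  have e4 : exp (ln 4) = 4 :> R by apply: Rexp_lnK.
  rewrite expr_Rexp // -/lq -[X in _ * (X * _)]e4 -!RexpD.
  rewrite (_ : _ + _ = ln q0') ?Rexp_lnK //; ring.
have xe : x * exp (2 * q0' + 1) <= 1.
  apply: (@le_trans _ _ (exp 0)); last by rewrite Rexp0.
  rewrite /x -RexpD; apply: Rler_exp.
  have -> : (ln q0' - ln 4 - h%:R * lq) / A + (2 * q0' + 1) =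
     (ln q0' - ln 4 - h%:R * lq + A * (2 * q0' + 1)) / A by field; rewrite gt_eqF.
  rewrite pmulr_lle0 ?invr_gt0 //; apply: ln_density_le0 => //.
    rewrite /nn /W -natrM ler_nat (leq_trans nh) // leq_mul2l leq_addr orbT //.
  by rewrite /nn /A /W -!natrM ler_nat.
have Cn' : C2 * (6 * A) ^+ 3 / cst <= nn.
  have C0 : 0 <= C2 * (6 * A) ^+ 3 / cst.
    apply: divr_ge0; last exact: ltW.
    apply: mulr_ge0; last by rewrite exprn_ge0 // mulr_ge0 // ltW.
    by rewrite /C2 -mulrA mulr_ge0 // mulr_ge0 // sqr_ge0.
  have /andP[_ h2] := truncn_itv C0; apply: le_trans (ltW h2) _.
  by rewrite /nn ler_nat.
have MB : 2 * rr ^+ 2 * (2 * rr * (2 * q0' + 1) + 3) ^+ 2 <= #|S|%:R * x.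
  apply: le_trans big.
  have e1 : C2 * nn ^+ 2 <= cst * exp (nn / (2 * A)) by apply: square_le_exp.
  have e2 : cst * exp (nn / (2 * A)) <= cst * exp ((k%:R - d%:R / A) * nn * lq + ln nn / A).
    rewrite ler_pM2l //; apply: Rler_exp.
    have ln0 : 0 <= ln nn / A.
      have l1 : ln 1 = 0 :> R by exact: ln_1.
      by apply: divr_ge0; [rewrite -l1; apply: Rler_ln|exact: ltW].
    (* As [d < k * a] in integers, the main exponent is at least [1 / A], so the bound grows
       exponentially in [nn] and passes [C2 * nn ^+ 2]. *)
    have kd : 1 / A <= k%:R - d%:R / A.
      by rewrite lerBrDr -mulrDl ler_pdivrMr // /A -natrM nat1r ler_nat.
    have kdl : 1 / A * (1 / 2) <= (k%:R - d%:R / A) * lq.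
      have iA : 0 <= 1 / A by apply: divr_ge0 => //; apply: ltW.
      by apply: ler_pM kd lq0 => //; lra.
    have := ler_wpM2r (ltW nn0) kdl.
    have -> : 1 / A * (1 / 2) * nn = nn / (2 * A) by field; rewrite gt_eqF.
    rewrite mulrAC; lra.
  apply: le_trans e2; apply: le_trans e1.
  rewrite /C2 -[X in _ <= X]mulrA -exprMn ler_wpM2l //.
    by rewrite mulr_ge0 // sqr_ge0.
  have q0'E : q0' = eta * nn by rewrite /q0' mulrC.
  rewrite q0'E; move: rr0 eta0 nn1; generalize rr eta nn => r' e' n' r0 e0 n1.
  have re0 : 0 <= r' * e' by rewrite mulr_ge0 // ltW.
  have ren0 : 0 <= r' * e' * n' by rewrite mulr_ge0 //; lra.
  have rn : 0 <= r' * (n' - 1) by rewrite mulr_ge0 //; lra.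
  rewrite ler_pXn2r ?nnegrE //; lra.
have [I [IS Ind Ibig]] := @large_independent_set _ (low_span_sets k a d S) S a _ q0' x
   tf ltac:(by move=> e; rewrite inE => /and3P[_ /eqP])
   ltac:(by move=> e; rewrite inE => /and3P[]) a0 x0 (ltW q0'0) HS xD xe MB.
have IB : (#|I| <= B F (k + m) k d.+1 a.+1)%N.
  apply: code_size_le_B; first exact: subset_trans IS SG.
  move=> e eI ce; rewrite addnS ltnNge; apply/negP => se.
  have := Ind e; rewrite inE (subset_trans eI IS) ce eqxx se eI /= => /(_ isT).
  by [].
have IB' : #|I|%:R <= (B F (k + m) k d.+1 a.+1)%:R :> R by rewrite ler_nat.
apply: le_trans IB'; apply: le_trans Ibig.
have w0 : 0 < (2 * (26 * rr + 12))^-1 by rewrite invr_gt0; lra.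
by rewrite -/rr mulrAC ler_pM2r.
Qed.

Lemma B_ge1 (F : finFieldType) (n k delta alpha : nat) :
  (k <= n)%N -> (1 < alpha)%N -> (1 <= B F n k delta alpha)%N.
Proof.
move=> kn al; rewrite -(subnKC kn); set m := (n - k)%N.
have /card_gt0P[U UG] : (0 < #|grassmannian F (k + m) k|)%N.
  by apply: leq_trans (card_grassmannian_ge F k m); rewrite expn_gt0 ltnW // finNzRing_gt1.
rewrite -(cards1 U); apply: code_size_le_B; first by rewrite sub1set.
by move=> e /subset_leq_card; rewrite cards1 => h E; rewrite E leqNgt al in h.
Qed.

(** The coefficient of [n * ln #|F|] is at most [- 1 / a], which outweighs [ln n / a]; the bound is
    at most 1, and a single codeword suffices. *)
Lemma code_lower_bound_degenerate (F : finFieldType) (k d a n : nat) :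
  (0 < a)%N -> (k * a < d)%N -> (k <= n)%N -> (0 < n)%N ->
  exp ((k%:R - d%:R / a%:R) * n%:R * ln #|F|%:R + ln n%:R / a%:R)
    <= (B F n k d.+1 a.+1)%:R.
Proof.
move=> a0 kad kn n0; apply: (@le_trans _ _ 1); last first.
  by rewrite ler1n B_ge1 // ltnS.
apply: (@le_trans _ _ (exp 0)); last by rewrite Rexp0.
apply: Rler_exp.
set A : R := a%:R; have A0 : 0 < A by rewrite ltr0n.
set nn : R := n%:R; have nn0 : 0 < nn by rewrite ltr0n.
have kd : (k%:R - d%:R / A) <= - (1 / A).
  have kA : k%:R * A + 1 <= d%:R by rewrite /A -natrM natr1 ler_nat.
  have -> : k%:R - d%:R / A = (k%:R * A - d%:R) / A by field; rewrite gt_eqF.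
  by rewrite -mulNr ler_pM2r ?invr_gt0 //; lra.
have lnn : ln nn <= nn / 2.
  have l2 : ln 2 <= 2 - 1 by apply: Rln_le_sub1.
  have n2 : 0 < nn / 2 by rewrite divr_gt0.
  have lh := Rln_le_sub1 n2.
  have -> : nn = 2 * (nn / 2) by field.
  by rewrite RlnM //; move: l2 lh; generalize (nn / 2) (ln 2); move=> *; lra.
have lq := ln_card_field_ge F; set l := ln _ in lq *.
have nl : nn / 2 <= nn * l by rewrite ler_pM2l //; lra.
have h1 : (k%:R - d%:R / A) * (nn * l) <= - (1 / A) * (nn * l).
  by rewrite ler_wpM2r // mulr_ge0 //; lra.
have h2 : (ln nn - nn * l) / A <= 0 by rewrite pmulr_lle0 ?invr_gt0 //; lra.
by rewrite -mulrA; move: h1 h2; lra.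
Qed.

Lemma Rpower_mul_Rpower (k d a n q : nat) :
  (Rpower (INR q) ((INR k - (INR d.+1 - 1) / (INR a.+1 - 1)) * INR n)
     * Rpower (INR n) (1 / (INR a.+1 - 1)))%R
  = exp ((k%:R - d%:R / a%:R) * n%:R * ln q%:R + ln n%:R / a%:R).
Proof.
rewrite /Rpower -exp_plus; congr exp.
have e x : (INR x.+1 - 1)%R = x%:R by rewrite S_INR INRE RminusE RplusE addrK.
rewrite !e !INRE !RealsE; congr (_ + _).
by rewrite mulrC div1r.
Qed.

(* q = #|F| ranges over all prime powers as F ranges over finite fields. *)
Theorem mainTheorem16 (F : finFieldType) (k delta alpha : nat) :
  (0 < k)%N -> (0 < delta)%N -> (3 <= alpha)%N ->
  gcdn (alpha - 1) (delta - 1) = 1%N ->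
  exists c : R, (0 < c)%R /\
    exists N : nat, forall n : nat, (N <= n)%N ->
      (c * Rpower (INR #|F|)
             ((INR k - (INR delta - 1) / (INR alpha - 1)) * INR n)
         * Rpower (INR n) (1 / (INR alpha - 1))
       <= INR (B F n k delta alpha))%R.
Proof.
case: delta => // d; case: alpha => // a _ _ a2; rewrite !subn1 /= => cop.
have bridge (c : R) n : (c * Rpower (INR #|F|)
       ((INR k - (INR d.+1 - 1) / (INR a.+1 - 1)) * INR n)
         * Rpower (INR n) (1 / (INR a.+1 - 1)))%R =
    c * exp ((k%:R - d%:R / a%:R) * n%:R * ln #|F|%:R + ln n%:R / a%:R).
  by rewrite Rmult_assoc Rpower_mul_Rpower.
have [kad|dka] := leqP (k * a) d; last first.
  have [c [c0 [N hN]]] := code_lower_bound F a2 cop dka.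
  exists c; split; first exact/RltP.
  exists N => n /hN h; apply/RleP; rewrite bridge INRE; exact: h.
(* Equality [k * a = d] would make the gcd equal to [a], which is at least 2. *)
have kad' : (k * a < d)%N.
  rewrite ltn_neqAle kad andbT; apply/eqP => E.
  by move: cop; rewrite -E gcdnMl => a1; rewrite a1 in a2.
exists 1%R; split; first exact: Rlt_0_1.
exists (maxn k 1) => n; rewrite geq_max => /andP[kn n0].
apply/RleP; rewrite bridge INRE mul1r.
by apply: code_lower_bound_degenerate => //; apply: ltnW.
Qed.
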